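(* Suppose that $f:G\to G'$ is an arbitrary homomorphism between finite groups. Then the following two squares of functors commute: $$\to_\bullet\circ\,\mathrm{Ho}(\mathrm{res}_f)=f^{-1}_L\circ\to_\bullet\ :\ \mathrm{Ho}(N\text{-}\mathbf{Op}^{G'})\longrightarrow\mathbf{Tr}(G),$$ $$\to_\bullet\circ\,\mathrm{Ho}(\mathrm{coind}_f)=f_R\circ\to_\bullet\ :\ \mathrm{Ho}(N\text{-}\mathbf{Op}^{G})\longrightarrow\mathbf{Tr}(G').$$
   Context: For a finite group $G$, $\mathbf{Op}^G$ is the category of symmetric operads in left $G$-sets, with $\mathscr{O}(n)$ regarded as a left $G\times\Sigma_n$-set via $(g,\sigma)\cdot x=gx\sigma^{-1}$. $N\text{-}\mathbf{Op}^G\subset\mathbf{Op}^G$ is the full subcategory of operads $\mathscr{O}$ such that for all $n\ge0$, $\mathscr{O}(n)$ is $\Sigma_n$-free and $\mathscr{O}(n)^G\neq\varnothing$ ($N$ operads). A graph subgroup of $G\times\Sigma_n$ is one of the form $\{(h,\sigma(h))\mid h\in H\}$ with $H\subset G$ a subgroup and $\sigma:H\to\Sigma_n$ a homomorphism. A morphism $\mathscr{O}\to\mathscr{P}$ is a weak equivalence iff for all $n\geq 0$ and all graph subgroups $\Gamma\subset G\times\Sigma_n$, $\mathscr{P}(n)^\Gamma\neq\varnothing$ implies $\mathscr{O}(n)^\Gamma\neq\varnothing$. $\mathrm{Ho}$ denotes localization at the weak equivalences. Viewing a $G$-operad as a functor from the one-object category $BG$ to operads in sets, $\mathrm{res}_f:\mathbf{Op}^{G'}\to\mathbf{Op}^G$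 is pullback along $Bf$ and $\mathrm{coind}_f:\mathbf{Op}^G\to\mathbf{Op}^{G'}$ is its right adjoint, right Kan extension along $Bf$. Both preserve $N$ operads and weak equivalences between $N$ operads, hence induce functors $\mathrm{Ho}(\mathrm{res}_f)$ and $\mathrm{Ho}(\mathrm{coind}_f)$. $\mathbf{Sub}(G)$ is the set of subgroups of $G$. A $G$-transfer system is a partial order $\to$ on $\mathbf{Sub}(G)$ such that $K\to H$ implies: $K\subset H$; $gKg^{-1}\to gHg^{-1}$ for every $g\in G$; and $L\cap K\to L$ for every subgroup $L\subset H$. $\mathbf{Tr}(G)$ is the poset (viewed as a category) of $G$-transfer systems under inclusion of relations. For an $N$ operad $\mathscr{O}$, $K\to_{\mathscr{O}}H$ iff $K\subset H$ and $\mathscr{O}(|H:K|)^{\Gamma(H/K)}\neq\varnothing$, where $\Gamma(H/K)\subset G\times\Sigma_{|H:K|}$ is the graph of a chosen permutation representation of the $H$-set $H/K$. The assignment $\mathscr{O}\mapsto\ \to_{\mathscr{O}}$ defines a functor $\to_\bullet:\mathrm{Ho}(N\text{-}\mathbf{Op}^G)\to\mathbf{Tr}(G)$. For $f:G\to G'$, a $G$-transfer system $\to$ and a $G'$-transfer system $\rightsquigarrow$: $f^{-1}_L(\rightsquigarrow)$ is the least $G$-transfer system containing $\{(f^{-1}K',f^{-1}H')\mid K'\rightsquigarrow H'\}$, and $f_R(\to)$ is the largest $G'$-transfer system contained in the partial order $\{(K',H')\mid K'\subset H'\subset G',\ f^{-1}K'\to f^{-1}H'\}$. *)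

(* Defs.v *)
From HB Require Import structures.
From mathcomp Require Import all_boot all_order.
From mathcomp Require Import all_fingroup.
From mathcomp Require Import boolp.

Set Implicit Arguments.
Unset Strict Implicit.
Unset Printing Implicit Defensive.

Local Open Scope group_scope.

#[local] Obligation Tactic := idtac.

Record category := Category {
  obj :> Type;
  hom : obj -> obj -> Type;
  idm : forall a, hom a a;
  cmp : forall x y z, hom y z -> hom x y -> hom x z;
  cmp1m : forall a b (u : hom a b), cmp (idm b) u = u;
  cmpm1 : forall a b (u : hom a b), cmp u (idm a) = u;
  cmpA : forall a b c d (w : hom c d) (v : hom b c) (u : hom a b),
    cmp w (cmp v u) = cmp (cmp w v) u }.

Arguments hom {_} _ _.
Arguments idm {_} _.
Arguments cmp {_ _ _ _} _ _.

Record functor (C D : category) := Functor {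
  fobj :> C -> D;
  fmap : forall a b, hom a b -> hom (fobj a) (fobj b);
  fmap1 : forall a, fmap (idm a) = idm (fobj a);
  fmapM : forall a b c (v : hom b c) (u : hom a b),
    fmap (cmp v u) = cmp (fmap v) (fmap u) }.

Arguments fmap {_ _} _ {_ _} _.

Program Definition comp_functor (C D E : category)
    (F : functor D E) (G : functor C D) : functor C E :=
  @Functor C E (fun a => F (G a)) (fun a b u => fmap F (fmap G u)) _ _.
Next Obligation. by move=> C D E F G a /=; rewrite !fmap1. Qed.
Next Obligation. by move=> C D E F G a b c v u /=; rewrite !fmapM. Qed.

Definition is_iso (C : category) (a b : C) (u : hom a b) : Prop :=
  exists2 v : hom b a, cmp v u = idm a & cmp u v = idm b.

Definition hom_class (C : category) := forall a b : C, hom a b -> Prop.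

Definition inverts (C D : category) (W : hom_class C) (F : functor C D) :=
  forall (a b : C) (w : hom a b), W a b w -> is_iso (fmap F w).

Record full_obj (C : category) (P : C -> Prop) :=
  FullObj { full_val : C; full_valP : P full_val }.

Program Definition full_subcat (C : category) (P : C -> Prop) : category :=
  @Category (full_obj P) (fun a b => hom (full_val a) (full_val b))
    (fun a => idm (full_val a)) (fun a b c v u => cmp v u) _ _ _.
Next Obligation. move=> C P a b u; exact: cmp1m. Qed.
Next Obligation. move=> C P a b u; exact: cmpm1. Qed.
Next Obligation. move=> C P a b c d w v u; exact: cmpA. Qed.

Program Definition full_functor (C D : category) (P : C -> Prop) (Q : D -> Prop)
    (F : functor C D) (FPQ : forall a, P a -> Q (F a)) :
    functor (full_subcat P) (full_subcat Q) :=
  @Functor (full_subcat P) (full_subcat Q)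
    (fun a => FullObj (FPQ _ (full_valP a)))
    (fun a b u => fmap F u) _ _.
Next Obligation. by move=> C D P Q F FPQ a; rewrite /= fmap1. Qed.
Next Obligation. by move=> C D P Q F FPQ a b c v u; rewrite /= fmapM. Qed.

(* [F] is left adjoint to [G]: there is a natural, universal counit F G -> 1. *)
Definition adjoint (C D : category) (F : functor C D) (G : functor D C) : Prop :=
  exists2 counit : forall b : D, hom (F (G b)) b,
    forall b b' (v : hom b b'), cmp v (counit b) = cmp (counit b') (fmap F (fmap G v))
  & forall (a : C) (b : D) (u : hom (F a) b),
      exists! v : hom a (G b), cmp (counit b) (fmap F v) = u.

(* The localization C[W^-1] of Gabriel and Zisman: formal composites of
   morphisms of C and of formal inverses of morphisms in W, modulo the evident
   relations.  Its universal property is [loc_factor] below. *)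
Section Localization.

Context (C : category) (W : hom_class C).

Inductive zigzag : C -> C -> Type :=
  | ZzHom a b : hom a b -> zigzag a b
  | ZzInv a b (w : hom a b) : W w -> zigzag b a
  | ZzCmp a b c : zigzag b c -> zigzag a b -> zigzag a c.

Inductive zzeq : forall a b, zigzag a b -> zigzag a b -> Prop :=
  | zzeq_refl a b (z : zigzag a b) : zzeq z z
  | zzeq_sym a b (y z : zigzag a b) : zzeq y z -> zzeq z y
  | zzeq_trans a b (x y z : zigzag a b) : zzeq x y -> zzeq y z -> zzeq x z
  | zzeq_cmp a b c (y y' : zigzag b c) (z z' : zigzag a b) :
      zzeq y y' -> zzeq z z' -> zzeq (ZzCmp y z) (ZzCmp y' z')
  | zzeq_cmpA a b c d (x : zigzag c d) (y : zigzag b c) (z : zigzag a b) :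
      zzeq (ZzCmp x (ZzCmp y z)) (ZzCmp (ZzCmp x y) z)
  | zzeq_1cmp a b (z : zigzag a b) : zzeq (ZzCmp (ZzHom (idm b)) z) z
  | zzeq_cmp1 a b (z : zigzag a b) : zzeq (ZzCmp z (ZzHom (idm a))) z
  | zzeq_hom a b c (v : hom b c) (u : hom a b) :
      zzeq (ZzHom (cmp v u)) (ZzCmp (ZzHom v) (ZzHom u))
  | zzeq_invl a b (w : hom a b) (Ww : W w) :
      zzeq (ZzCmp (ZzInv Ww) (ZzHom w)) (ZzHom (idm a))
  | zzeq_invr a b (w : hom a b) (Ww : W w) :
      zzeq (ZzCmp (ZzHom w) (ZzInv Ww)) (ZzHom (idm b)).

(* Equivalence classes of zigzags, as predicates. *)
Record loc_hom a b := LocHom {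
  loc_class : zigzag a b -> Prop;
  loc_classP : exists z, loc_class = @zzeq a b z }.

Definition loc_pi a b (z : zigzag a b) : loc_hom a b :=
  LocHom (ex_intro (fun y => @zzeq a b z = @zzeq a b y) z erefl).

Definition loc_repr a b (u : loc_hom a b) : zigzag a b := sval (cid (loc_classP u)).

Lemma loc_reprK a b (u : loc_hom a b) : loc_pi (loc_repr u) = u.
Proof.
rewrite /loc_repr; case: cid => z /= uz; case: u uz => c cP /= cz.
by case: _ / (esym cz) in cP *; congr LocHom; exact: Prop_irrelevance.
Qed.

Lemma loc_piP a b (y z : zigzag a b) : loc_pi y = loc_pi z <-> zzeq y z.
Proof.
split=> [/(congr1 (@loc_class a b))/= yz|yz].
  by rewrite yz; exact: zzeq_refl.
have e : @zzeq a b y = @zzeq a b z.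
  apply: funext => x; apply: propext; split; apply: zzeq_trans => //.
  exact: zzeq_sym.
rewrite /loc_pi; move: (ex_intro _ z _); case: _ / e => p.
by congr LocHom; exact: Prop_irrelevance.
Qed.

Lemma repr_loc_pi a b (z : zigzag a b) : zzeq (loc_repr (loc_pi z)) z.
Proof. by apply/loc_piP; rewrite loc_reprK. Qed.

Definition loc_cmp a b c (v : loc_hom b c) (u : loc_hom a b) : loc_hom a c :=
  loc_pi (ZzCmp (loc_repr v) (loc_repr u)).

Lemma loc_cmpE a b c (y : zigzag b c) (z : zigzag a b) :
  loc_cmp (loc_pi y) (loc_pi z) = loc_pi (ZzCmp y z).
Proof. by apply/loc_piP/zzeq_cmp; exact: repr_loc_pi. Qed.

Program Definition localization : category :=
  @Category C loc_hom (fun a => loc_pi (ZzHom (idm a))) loc_cmp _ _ _.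
Next Obligation.
by move=> a b u; rewrite -(loc_reprK u) loc_cmpE; exact/loc_piP/zzeq_1cmp.
Qed.
Next Obligation.
by move=> a b u; rewrite -(loc_reprK u) loc_cmpE; exact/loc_piP/zzeq_cmp1.
Qed.
Next Obligation.
move=> a b c d w v u.
rewrite -(loc_reprK u) -(loc_reprK v) -(loc_reprK w) !loc_cmpE.
exact/loc_piP/zzeq_cmpA.
Qed.

Program Definition loc_functor : functor C localization :=
  @Functor C localization (fun a => a) (fun a b u => loc_pi (ZzHom u)) _ _.
Next Obligation. by []. Qed.
Next Obligation.
by move=> a b c v u; rewrite /= loc_cmpE; exact/loc_piP/zzeq_hom.
Qed.

Lemma loc_functor_inverts : inverts W loc_functor.
Proof.
move=> a b w Ww; exists (loc_pi (ZzInv Ww)); rewrite /= loc_cmpE.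
  exact/loc_piP/zzeq_invl.
exact/loc_piP/zzeq_invr.
Qed.

Section Lift.

Context (D : category) (F : functor C D) (FW : inverts W F).

Definition inv_of a b (w : hom a b) (Ww : W w) : hom (F b) (F a) :=
  sval (cid2 (FW Ww)).

Fixpoint zz_eval a b (z : zigzag a b) : hom (F a) (F b) :=
  match z with
  | ZzHom _ _ u => fmap F u
  | ZzInv _ _ _ Ww => inv_of Ww
  | ZzCmp _ _ _ y z => cmp (zz_eval y) (zz_eval z)
  end.

Lemma zz_eval_eq a b (y z : zigzag a b) : zzeq y z -> zz_eval y = zz_eval z.
Proof.
elim=> {a b y z} //=.
- by move=> a b x y z _ -> _ ->.
- by move=> a b c y y' z z' _ -> _ ->.
- by move=> a b c d x y z; rewrite cmpA.
- by move=> a b z; rewrite fmap1 cmp1m.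
- by move=> a b z; rewrite fmap1 cmpm1.
- by move=> a b c v u; rewrite fmapM.
- by move=> a b w Ww; rewrite /inv_of fmap1; case: cid2.
- by move=> a b w Ww; rewrite /inv_of fmap1; case: cid2.
Qed.

Program Definition loc_lift : functor localization D :=
  @Functor localization D F (fun a b u => zz_eval (loc_repr u)) _ _.
Next Obligation.
by move=> a /=; rewrite (zz_eval_eq (repr_loc_pi _)) /= fmap1.
Qed.
Next Obligation.
by move=> a b c v u /=; rewrite (zz_eval_eq (repr_loc_pi _)).
Qed.

End Lift.

End Localization.

Lemma sigT_inj (T : Type) (P : T -> Type) (x : T) (u v : P x) :
  existT P x u = existT P x v -> u = v.
Proof.
move=> e; have := projT2_eq e.
by rewrite (Prop_irrelevance (projT1_eq e) erefl).
Qed.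

Lemma functor_ext (C D : category) (F G : functor C D) (FG : forall a, F a = G a) :
  (forall a b (u : hom a b),
     ecast y (hom (F a) y) (FG b) (fmap F u)
     = ecast x (hom x (G b)) (esym (FG a)) (fmap G u)) -> F = G.
Proof.
case: F G FG => F Fm F1 FM [G Gm G1 GM] /= FG.
have eFG : F = G by exact: funext.
case: _ / eFG in Gm G1 GM FG * => eFmGm.
have eFm : Fm = Gm.
  apply: functional_extensionality_dep => a; apply: functional_extensionality_dep => b.
  apply: functional_extensionality_dep => u; move: (eFmGm a b u).
  by rewrite (Prop_irrelevance (FG a) erefl) (Prop_irrelevance (FG b) erefl).
by case: _ / eFm in G1 GM *; congr Functor; exact: Prop_irrelevance.
Qed.

Lemma cmp_inverse_unique (C : category) (a b : C) (u : hom a b) (v v' : hom b a) :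
  cmp v u = idm a -> cmp u v' = idm b -> v = v'.
Proof. by move=> vu uv'; rewrite -[v]cmpm1 -uv' cmpA vu cmp1m. Qed.

Lemma loc_liftE (C D : category) (W : hom_class C) (F : functor C D)
  (FW : inverts W F) : comp_functor (loc_lift FW) (loc_functor W) = F.
Proof.
apply: (@functor_ext C D (comp_functor (loc_lift FW) (loc_functor W)) F
  (fun a => erefl (F a))) => a b u /=.
by rewrite (zz_eval_eq FW (repr_loc_pi _)).
Qed.

Lemma loc_unique (C D : category) (W : hom_class C) (F G : functor (localization W) D) :
  comp_functor F (loc_functor W) = comp_functor G (loc_functor W) -> F = G.
Proof.
case: F G => F Fm F1 FM [G Gm G1 GM] eFG.
have eFG0 : F = G by exact: (congr1 (@fobj C D) eFG).
case: _ / eFG0 in Gm G1 GM eFG *.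
have eFGm : forall a b (u : @hom C a b), Fm _ _ (loc_pi (ZzHom W u)) = Gm _ _ (loc_pi (ZzHom W u)).
  pose tot (K : functor C D) := existT
    (fun o : C -> D => forall a b : C, hom a b -> hom (o a) (o b)) K (@fmap C D K).
  by move=> a b u; move: (sigT_inj (congr1 tot eFG)) => /(congr1 (fun m => m a b u)).
have eFm : Fm = Gm.
  apply: functional_extensionality_dep => a; apply: functional_extensionality_dep => b.
  apply: functional_extensionality_dep => u; rewrite -(loc_reprK u).
  elim: (loc_repr u) => {a b u} [a b u|a b w Ww|a b c y IHy z IHz].
  - exact: eFGm.
  - have [wv vw] : loc_cmp (loc_pi (ZzInv Ww)) (loc_pi (ZzHom W w)) = loc_pi (ZzHom W (idm a)) /\
      loc_cmp (loc_pi (ZzHom W w)) (loc_pi (ZzInv Ww)) = loc_pi (ZzHom W (idm b)).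
      by rewrite !loc_cmpE; split; [exact/loc_piP/zzeq_invl|exact/loc_piP/zzeq_invr].
    apply: (@cmp_inverse_unique D _ _ (Fm _ _ (loc_pi (ZzHom W w)))).
      by rewrite -FM /= wv F1.
    by rewrite eFGm -GM /= vw G1.
  - by rewrite -loc_cmpE FM IHy IHz -GM.
by case: _ / eFm in G1 GM eFG eFGm *; congr Functor; exact: Prop_irrelevance.
Qed.

Lemma loc_factor (C D : category) (W : hom_class C) (F : functor C D) :
  inverts W F -> exists! G : functor (localization W) D,
    comp_functor G (loc_functor W) = F.
Proof.
move=> FW; exists (loc_lift FW); split; first exact: loc_liftE.
by move=> G GF; apply: (@loc_unique C D W); rewrite loc_liftE.
Qed.

(* The functor Ho(F) induced by a functor F that preserves weak equivalences. *)
Definition loc_map (C D : category) (W : hom_class C) (V : hom_class D)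
    (F : functor C D) (FWV : forall a b (u : hom a b), W a b u -> V _ _ (fmap F u)) :
    functor (localization W) (localization V) :=
  @loc_lift C W (localization V) (comp_functor (loc_functor V) F)
    (fun a b u Wu => loc_functor_inverts (FWV a b u Wu)).

(* The symmetric group with (s * t) i = s (t i), as is usual for operads:
   MathComp's product on 'S_n is the opposite one. *)
Definition Sigma (n : nat) : Type := 'S_n.
Definition Sigma_perm n (s : Sigma n) : 'S_n := s.
Coercion Sigma_perm : Sigma >-> perm_of.
HB.instance Definition _ n := Finite.copy (Sigma n) 'S_n.

Section SigmaGroup.
Context (n : nat).
Definition Sigma_mul (s t : Sigma n) : Sigma n := ((t : 'S_n) * (s : 'S_n))%g.
Definition Sigma_one : Sigma n := (1%g : 'S_n).
Definition Sigma_inv (s : Sigma n) : Sigma n := ((s : 'S_n)^-1)%g.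
Fact Sigma_mulA : associative Sigma_mul.
Proof. by move=> s t u; rewrite /Sigma_mul /Sigma_perm mulgA. Qed.
Fact Sigma_mul1 : left_id Sigma_one Sigma_mul.
Proof. by move=> s; rewrite /Sigma_mul /Sigma_perm mulg1. Qed.
Fact Sigma_mulV : left_inverse Sigma_one Sigma_inv Sigma_mul.
Proof. by move=> s; rewrite /Sigma_mul /Sigma_perm mulgV. Qed.
HB.instance Definition _ :=
  Finite_isGroup.Build (Sigma n) Sigma_mulA Sigma_mul1 Sigma_mulV.
End SigmaGroup.

Lemma Sigma_mulE n (s t : Sigma n) i : (s * t) i = s (t i).
Proof. by rewrite /= /Sigma_perm; exact: permM. Qed.

Lemma Sigma_1E n i : (1 : Sigma n) i = i.
Proof. exact: perm1. Qed.

Definition mk_Sigma n (h : 'I_n -> 'I_n) (inj_h : injective h) : Sigma n :=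
  perm inj_h.

Lemma mk_SigmaE n (h : 'I_n -> 'I_n) (inj_h : injective h) i :
  mk_Sigma inj_h i = h i.
Proof. exact: permE. Qed.

Lemma Sigma_inj n (s : Sigma n) : injective s.
Proof. exact: perm_inj. Qed.

Lemma Sigma_ext n (s t : Sigma n) : s =1 t -> s = t.
Proof. by move=> st; apply/permP. Qed.

(* Inputs of a composite gamma(x; y_0, ..., y_(n-1)), with y_i of arity k i, are
   numbered lexicographically: [tagnat.Rank i j] is the j-th input of y_i. *)
Section BlockPermutations.

Context (n : nat) (k : 'I_n -> nat).

(* (i, j) |-> (i, t i j) *)
Definition sum_perm_fun (t : forall i, Sigma (k i)) (u : 'I_(\sum_i k i)) :
    'I_(\sum_i k i) :=
  tagnat.Rank (tagnat.sig1 u) (t (tagnat.sig1 u) (tagnat.sig2 u)).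

Fact sum_perm_inj t : injective (sum_perm_fun t).
Proof.
move=> u v /tagnat.rank_inj uv; apply: tagnat.sig_inj.
rewrite [LHS]tagnat.sigE12 [RHS]tagnat.sigE12.
move: (tagnat.sig1 u) (tagnat.sig2 u) (tagnat.sig1 v) (tagnat.sig2 v) uv.
move=> i a j b e; have eij : i = j := congr1 tag e.
by case: _ / eij in b e *; move: (sigT_inj e) => /Sigma_inj ->.
Qed.

Definition sum_perm t : Sigma (\sum_i k i) := mk_Sigma (@sum_perm_inj t).

Context (s : Sigma n).

Fact block_eq : \sum_i k i = \sum_i k (s i).
Proof. by rewrite (reindex_inj (@Sigma_inj n s)). Qed.

(* (i, j) |-> (s i, j) for j < k (s i): the blocks of sizes k (s 0), k (s 1), ...
   are rearranged into blocks of sizes k 0, k 1, ... *)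
Definition block_perm_fun (u : 'I_(\sum_i k i)) : 'I_(\sum_i k i) :=
  let v := cast_ord block_eq u in tagnat.Rank (s (tagnat.sig1 v)) (tagnat.sig2 v).

Fact block_perm_inj : injective block_perm_fun.
Proof.
move=> u v /tagnat.rank_inj; set u' := cast_ord _ u; set v' := cast_ord _ v.
move=> uv; suff : u' = v' by move/cast_ord_inj.
apply: tagnat.sig_inj; rewrite [LHS]tagnat.sigE12 [RHS]tagnat.sigE12.
move: (tagnat.sig1 u') (tagnat.sig2 u') (tagnat.sig1 v') (tagnat.sig2 v') uv.
move=> i a j b e; have eij : i = j := Sigma_inj (congr1 tag e).
by case: _ / eij in b e *; move: (sigT_inj e) => /= ->.
Qed.

Definition block_perm : Sigma (\sum_i k i) := mk_Sigma block_perm_inj.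

End BlockPermutations.

(* Equality of operations whose arities are only propositionally equal. *)
Notation "x =[ O ]= y" := (existT O _ x = existT O _ y)
  (at level 70, O at level 0, format "x  =[ O ]=  y").

(* A symmetric operad in sets, with composition
   gamma : O(n) x O(k_0) x ... x O(k_(n-1)) -> O(k_0 + ... + k_(n-1)).
   The right actions follow the convention (x . s)(a) = x (a o s^-1) of the
   endomorphism operad, for inputs a : {0, ..., n-1} -> X. *)
Record operad := Operad {
  ar :> nat -> Type;
  sact : forall n, ar n -> Sigma n -> ar n;
  op_unit : ar 1;
  gamma : forall n (k : 'I_n -> nat), ar n -> (forall i, ar (k i)) -> ar (\sum_i k i);
  sact1 : forall n (x : ar n), sact x 1 = x;
  sactM : forall n (x : ar n) (s t : Sigma n), sact x (s * t) = sact (sact x s) t;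
  gamma1x : forall (k : 'I_1 -> nat) (y : forall i, ar (k i)),
    gamma op_unit y =[ar]= y ord0;
  gammax1 : forall n (x : ar n), gamma x (fun _ => op_unit) =[ar]= x;
  gammaA : forall n (k : 'I_n -> nat) (l : 'I_(\sum_i k i) -> nat)
      (x : ar n) (y : forall i, ar (k i)) (z : forall u, ar (l u)),
    gamma (gamma x y) z
    =[ar]= gamma x (fun i => gamma (y i) (fun j => z (tagnat.Rank i j)));
  gamma_sact_inner : forall n (k : 'I_n -> nat) (x : ar n) (y : forall i, ar (k i))
      (t : forall i, Sigma (k i)),
    gamma x (fun i => sact (y i) (t i)) = sact (gamma x y) (sum_perm t);
  gamma_sact_outer : forall n (k : 'I_n -> nat) (x : ar n) (y : forall i, ar (k i))
      (s : Sigma n),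
    gamma (sact x s) (fun i => y (s i)) =[ar]= sact (gamma x y) (block_perm k s) }.

Arguments sact {_ _} _ _.
Arguments op_unit {_}.
Arguments gamma {_ _ _} _ _.

(* A G-operad: an operad in G-sets, or a functor from BG to operads in sets. *)
Record goperad (gT : finGroupType) := GOperad {
  gop :> operad;
  gact : forall n, gT -> gop n -> gop n;
  gact1 : forall n (x : gop n), gact 1 x = x;
  gactM : forall n (g h : gT) (x : gop n), gact (g * h) x = gact g (gact h x);
  gact_sact : forall n (g : gT) (x : gop n) (s : Sigma n),
    gact g (sact x s) = sact (gact g x) s;
  gact_unit : forall g : gT, gact g op_unit = op_unit;
  gact_gamma : forall n (k : 'I_n -> nat) (g : gT) (x : gop n) (y : forall i, gop (k i)),
    gact g (gamma x y) = gamma (gact g x) (fun i => gact g (y i)) }.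

Arguments gact {_ _ _} _ _.

Record gophom (gT : finGroupType) (O P : goperad gT) := GOpHom {
  gohom :> forall n, O n -> P n;
  gohom_gact : forall n (g : gT) (x : O n), gohom (gact g x) = gact g (gohom x);
  gohom_sact : forall n (x : O n) (s : Sigma n), gohom (sact x s) = sact (gohom x) s;
  gohom_unit : gohom (@op_unit O) = op_unit;
  gohom_gamma : forall n (k : 'I_n -> nat) (x : O n) (y : forall i, O (k i)),
    gohom (gamma x y) = gamma (gohom x) (fun i => gohom (y i)) }.

Arguments gohom {_ _ _} _ {_} _.

Lemma gophom_ext (gT : finGroupType) (O P : goperad gT) (u v : gophom O P) :
  (forall n (x : O n), u n x = v n x) -> u = v.
Proof.
case: u v => u u1 u2 u3 u4 [v v1 v2 v3 v4] /= uv.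
have {}uv : u = v.
  by apply: functional_extensionality_dep => n; apply: funext => x; exact: uv.
by case: _ / uv in v1 v2 v3 v4 *; congr GOpHom; exact: Prop_irrelevance.
Qed.

Program Definition gophom_id (gT : finGroupType) (O : goperad gT) : gophom O O :=
  @GOpHom gT O O (fun n x => x) _ _ _ _.
Solve Obligations with by [].

Program Definition gophom_cmp (gT : finGroupType) (O P Q : goperad gT)
    (v : gophom P Q) (u : gophom O P) : gophom O Q :=
  @GOpHom gT O Q (fun n x => v n (u n x)) _ _ _ _.
Next Obligation. by move=> * /=; rewrite !gohom_gact. Qed.
Next Obligation. by move=> * /=; rewrite !gohom_sact. Qed.
Next Obligation. by move=> * /=; rewrite !gohom_unit. Qed.
Next Obligation. by move=> * /=; rewrite !gohom_gamma. Qed.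

Program Definition Op (gT : finGroupType) : category :=
  @Category (goperad gT) (@gophom gT) (@gophom_id gT) (@gophom_cmp gT) _ _ _.
Next Obligation. by move=> *; apply: gophom_ext. Qed.
Next Obligation. by move=> *; apply: gophom_ext. Qed.
Next Obligation. by move=> *; apply: gophom_ext. Qed.

(* The left action (g, s) . x = g x s^-1 of G x Sigma_n on O(n). *)
Definition gsact (gT : finGroupType) (O : goperad gT) n (p : gT * Sigma n) (x : O n) :=
  gact p.1 (sact x p.2^-1).

Definition is_fixed (gT : finGroupType) (O : goperad gT) n (A : {set gT * Sigma n})
    (x : O n) : Prop :=
  forall p, p \in A -> gsact p x = x.

Definition has_fixed (gT : finGroupType) (O : goperad gT) n (A : {set gT * Sigma n}) :
    Prop :=
  exists x : O n, is_fixed A x.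

Definition graph_subgroup (gT : finGroupType) n (A : {group gT * Sigma n}) : Prop :=
  exists (H : {group gT}) (s : {morphism H >-> Sigma n}),
    A = [set (h, s h) | h in H] :> {set gT * Sigma n}.

Definition is_N (gT : finGroupType) (O : Op gT) : Prop :=
  forall n, (forall (x : O n) (s : Sigma n), sact x s = x -> s = 1)
    /\ (exists x : O n, forall g : gT, gact g x = x).

Definition NOp (gT : finGroupType) : category := full_subcat (@is_N gT).

Definition NOp_gop (gT : finGroupType) (O : NOp gT) : goperad gT := full_val O.
Coercion NOp_gop : obj >-> goperad.

Definition weq (gT : finGroupType) (O P : goperad gT) (_ : gophom O P) : Prop :=
  forall n (A : {group gT * Sigma n}),
    graph_subgroup A -> has_fixed P A -> has_fixed O A.

Section ResCoind.

Context (gT gT' : finGroupType) (f : {morphism [set: gT] >-> gT'}).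

Lemma morphT g h : f (g * h) = f g * f h.
Proof. by rewrite morphM ?inE. Qed.

Program Definition res (P : goperad gT') : goperad gT :=
  @GOperad gT P (fun n g x => gact (f g) x) _ _ _ _ _.
Next Obligation. by move=> P n x /=; rewrite morph1 gact1. Qed.
Next Obligation. by move=> P n g h x /=; rewrite morphT gactM. Qed.
Next Obligation. by move=> P n g x s; exact: gact_sact. Qed.
Next Obligation. by move=> P g; exact: gact_unit. Qed.
Next Obligation. by move=> P n k g x y; exact: gact_gamma. Qed.

Program Definition res_hom (P Q : goperad gT') (u : gophom P Q) :
    gophom (res P) (res Q) := @GOpHom gT (res P) (res Q) (fun n x => u n x) _ _ _ _.
Next Obligation. by move=> P Q u n g x; exact: (gohom_gact u). Qed.
Next Obligation. by move=> P Q u n x s; exact: (gohom_sact u). Qed.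
Next Obligation. by move=> P Q u; exact: (gohom_unit u). Qed.
Next Obligation. by move=> P Q u n k x y; exact: (gohom_gamma u). Qed.

Program Definition res_functor : functor (Op gT') (Op gT) :=
  @Functor (Op gT') (Op gT) res res_hom _ _.
Next Obligation. by move=> P; apply: gophom_ext. Qed.
Next Obligation. by move=> P Q R v u; apply: gophom_ext. Qed.

(* The right Kan extension of O along Bf is the limit of O over the comma category
   ( * | Bf ): an element is a family of elements of O indexed by the objects of
   that category, which are the elements of G', compatible with its morphisms
   g : x -> f(g) x.  Limits of operads are computed levelwise. *)
Section Coind.

Context (O : goperad gT).

Record coind_ar (n : nat) := Coind {
  coind_val : gT' -> O n;
  coind_valP : forall (g : gT) (x : gT'), coind_val (f g * x) = gact g (coind_val x) }.

Lemma coind_ext n (p q : coind_ar n) : (forall x, coind_val p x = coind_val q x) -> p = q.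
Proof.
case: p q => p p1 [q q1] /= pq; have {}pq : p = q by exact: funext.
by case: _ / pq in q1 *; congr Coind; exact: Prop_irrelevance.
Qed.

Lemma coind_tag_ext m n (p : coind_ar m) (q : coind_ar n) :
  (forall x, coind_val p x =[O]= coind_val q x) -> p =[coind_ar]= q.
Proof.
move=> pq; have emn : m = n := congr1 (@projT1 _ _) (pq 1).
case: _ / emn in q pq *; congr existT; apply: coind_ext => x.
exact: sigT_inj (pq x).
Qed.

Program Definition coind_sact n (p : coind_ar n) (s : Sigma n) : coind_ar n :=
  @Coind _ (fun x => sact (coind_val p x) s) _.
Next Obligation. by move=> n [p p1] s g x /=; rewrite p1 gact_sact. Qed.

Program Definition coind_unit : coind_ar 1 := @Coind _ (fun=> op_unit) _.
Next Obligation. by move=> g x /=; rewrite gact_unit. Qed.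

Program Definition coind_gamma n (k : 'I_n -> nat) (p : coind_ar n)
    (q : forall i, coind_ar (k i)) : coind_ar (\sum_i k i) :=
  @Coind _ (fun x => gamma (coind_val p x) (fun i => coind_val (q i) x)) _.
Next Obligation.
move=> n k [p p1] q g x /=; rewrite p1 gact_gamma; congr gamma.
by apply: functional_extensionality_dep => i; case: (q i) => r r1 /=.
Qed.

Program Definition coind_operad : operad :=
  @Operad coind_ar coind_sact coind_unit coind_gamma _ _ _ _ _ _ _.
Next Obligation. by move=> n p; apply: coind_ext => x /=; rewrite sact1. Qed.
Next Obligation. by move=> n p s t; apply: coind_ext => x /=; rewrite sactM. Qed.
Next Obligation.
by move=> k q; apply: coind_tag_ext => x /=; rewrite gamma1x.
Qed.
Next Obligation. by move=> n p; apply: coind_tag_ext => x /=; exact: gammax1. Qed.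
Next Obligation.
by move=> n k l p q r; apply: coind_tag_ext => x /=; exact: gammaA.
Qed.
Next Obligation.
by move=> n k p q t; apply: coind_ext => x /=; exact: gamma_sact_inner.
Qed.
Next Obligation.
move=> n k p q s; apply: coind_tag_ext => x /=.
exact: (gamma_sact_outer _ (fun i => coind_val (q i) x)).
Qed.

Program Definition coind_gact n (g : gT') (p : coind_ar n) : coind_ar n :=
  @Coind _ (fun x => coind_val p (x * g)) _.
Next Obligation. by move=> n g [p p1] h x /=; rewrite -mulgA p1. Qed.

Program Definition coind : goperad gT' :=
  @GOperad gT' coind_operad coind_gact _ _ _ _ _.
Next Obligation. by move=> n p; apply: coind_ext => x /=; rewrite mulg1. Qed.
Next Obligation. by move=> n g h p; apply: coind_ext => x /=; rewrite mulgA. Qed.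
Next Obligation. by move=> n g p s; exact: coind_ext. Qed.
Next Obligation. by move=> g; exact: coind_ext. Qed.
Next Obligation. by move=> n k g p q; exact: coind_ext. Qed.

End Coind.

Program Definition coind_map (O P : goperad gT) (u : gophom O P) n (p : coind O n) :
    coind P n := @Coind P n (fun x => u n (coind_val p x)) _.
Next Obligation. by move=> O P u n [p p1] g x /=; rewrite p1 gohom_gact. Qed.

Program Definition coind_hom (O P : goperad gT) (u : gophom O P) :
    gophom (coind O) (coind P) :=
  @GOpHom gT' (coind O) (coind P) (@coind_map O P u) _ _ _ _.
Next Obligation. by move=> O P u n g p; exact: coind_ext. Qed.
Next Obligation.
by move=> O P u n p s; apply: coind_ext => x /=; exact: gohom_sact.
Qed.
Next Obligation. by move=> O P u; apply: coind_ext => x /=; exact: gohom_unit. Qed.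
Next Obligation.
by move=> O P u n k p q; apply: coind_ext => x /=; exact: gohom_gamma.
Qed.

Program Definition coind_functor : functor (Op gT) (Op gT') :=
  @Functor (Op gT) (Op gT') coind coind_hom _ _.
Next Obligation. by move=> O; apply: gophom_ext => n p; exact: coind_ext. Qed.
Next Obligation. by move=> O P Q v u; apply: gophom_ext => n p; exact: coind_ext. Qed.

Program Definition coind_counit (O : goperad gT) : gophom (res (coind O)) O :=
  @GOpHom gT (res (coind O)) O (fun n p => coind_val p 1) _ _ _ _.
Next Obligation. by move=> O n g [p p1] /=; rewrite -p1 mul1g mulg1. Qed.
Next Obligation. by []. Qed.
Next Obligation. by []. Qed.
Next Obligation. by []. Qed.

Program Definition coind_adj_fun (P : goperad gT') (O : goperad gT)
    (u : gophom (res P) O) n (x : P n) : coind O n :=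
  @Coind O n (fun g' => u n (gact g' x)) _.
Next Obligation.
by move=> P O u n x g g' /=; rewrite gactM -(gohom_gact u).
Qed.

Program Definition coind_adj (P : goperad gT') (O : goperad gT)
    (u : gophom (res P) O) : gophom P (coind O) :=
  @GOpHom gT' P (coind O) (coind_adj_fun u) _ _ _ _.
Next Obligation.
by move=> P O u n g x; apply: coind_ext => g' /=; rewrite gactM.
Qed.
Next Obligation.
move=> P O u n x s; apply: coind_ext => g' /=; rewrite gact_sact.
exact: (gohom_sact u).
Qed.
Next Obligation.
move=> P O u; apply: coind_ext => g' /=; rewrite gact_unit; exact: (gohom_unit u).
Qed.
Next Obligation.
move=> P O u n k x y; apply: coind_ext => g' /=; rewrite gact_gamma.
exact: (gohom_gamma u).
Qed.

Lemma res_coind_adjoint : adjoint res_functor coind_functor.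
Proof.
exists coind_counit => [O P v|P O u]; first exact: gophom_ext.
exists (coind_adj u); split.
  by apply: gophom_ext => n x /=; rewrite gact1.
move=> v <-; apply: gophom_ext => n x; apply: coind_ext => g' /=.
by rewrite gohom_gact /= mul1g.
Qed.

Lemma res_is_N (P : Op gT') : is_N P -> is_N (res_functor P).
Proof.
move=> PN n; have [Pfree [x xG]] := PN n; split; first exact: Pfree.
by exists x => g; exact: xG.
Qed.

Lemma coind_is_N (O : Op gT) : is_N O -> is_N (coind_functor O).
Proof.
move=> ON n; have [Ofree [x xG]] := ON n; split.
  by move=> p s /(congr1 (fun q => coind_val q 1)) /Ofree.
by exists (@Coind O n (fun=> x) (fun g _ => esym (xG g))) => g'; exact: coind_ext.
Qed.

Definition res_N : functor (NOp gT') (NOp gT) := full_functor res_is_N.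
Definition coind_N : functor (NOp gT) (NOp gT') := full_functor coind_is_N.

End ResCoind.

(* A finite group G is represented by a finGroupType gT, and its subgroups by
   the elements of {group gT}; note that g K g^-1 is K :^ g^-1 in MathComp. *)
Record transfer_system (gT : finGroupType) := TransferSystem {
  tr :> {group gT} -> {group gT} -> Prop;
  tr_refl : forall H, tr H H;
  tr_trans : forall L K H, tr L K -> tr K H -> tr L H;
  tr_antisym : forall K H, tr K H -> tr H K -> K = H;
  tr_sub : forall K H : {group gT}, tr K H -> K \subset H;
  tr_conj : forall (K H : {group gT}) (g : gT),
    tr K H -> tr (K :^ g^-1)%G (H :^ g^-1)%G;
  tr_res : forall K H L : {group gT}, tr K H -> L \subset H -> tr (L :&: K)%G L }.

Definition tr_le (gT : finGroupType) (S T : {group gT} -> {group gT} -> Prop) : Prop :=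
  forall K H, S K H -> T K H.

Program Definition Tr (gT : finGroupType) : category :=
  @Category (transfer_system gT) (fun S T => tr_le S T)
    (fun T K H => id) (fun S T U TU ST K H SKH => TU K H (ST K H SKH)) _ _ _.
Next Obligation. by []. Qed.
Next Obligation. by []. Qed.
Next Obligation. by []. Qed.

Lemma Tr_thin (gT : finGroupType) (S T : Tr gT) (u v : hom S T) : u = v.
Proof. exact: (@Prop_irrelevance (tr_le (S : transfer_system gT) (T : transfer_system gT)) u v). Qed.

Lemma transfer_ext (gT : finGroupType) (S T : transfer_system gT) :
  (forall K H, S K H <-> T K H) -> S = T.
Proof.
case: S T => S S1 S2 S3 S4 S5 S6 [T T1 T2 T3 T4 T5 T6] /= ST.
have {}ST : S = T.
  by apply: funext => K; apply: funext => H; exact: propext.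
case: _ / ST in T1 T2 T3 T4 T5 T6 *; congr TransferSystem; exact: Prop_irrelevance.
Qed.

Section LeastLargest.

Context (gT : finGroupType) (R : {group gT} -> {group gT} -> Prop).

Lemma group_eq_sub (K H : {group gT}) : K \subset H -> H \subset K -> K = H.
Proof. by move=> KH HK; apply/val_inj/eqP; rewrite eqEsubset KH. Qed.

(* The intersection of all transfer systems that contain R; the condition
   K \subset H is automatic if R itself refines inclusion. *)
Program Definition tr_least : transfer_system gT :=
  @TransferSystem gT
    (fun K H => K \subset H /\ forall T : transfer_system gT, tr_le R T -> T K H)
    _ _ _ _ _ _.
Next Obligation. by move=> H; split=> // T _; exact: tr_refl. Qed.
Next Obligation.
move=> L K H [LK TLK] [KH TKH]; split; first exact: subset_trans KH.
by move=> T RT; exact: tr_trans (TLK T RT) (TKH T RT).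
Qed.
Next Obligation. by move=> K H [KH _] [HK _]; exact: group_eq_sub. Qed.
Next Obligation. by move=> K H []. Qed.
Next Obligation.
move=> K H g [KH TKH]; split; first by rewrite /= conjSg.
by move=> T RT; exact/tr_conj/TKH.
Qed.
Next Obligation.
move=> K H L [KH TKH] LH; split; first exact: subsetIl.
by move=> T RT; apply: tr_res LH; exact: TKH.
Qed.

(* The join of all transfer systems contained in R, i.e. the transitive closure
   of their union. *)
Inductive tr_join : {group gT} -> {group gT} -> Prop :=
  | tr_join_refl H : tr_join H H
  | tr_join_step (T : transfer_system gT) L K H :
      tr_le T R -> T L K -> tr_join K H -> tr_join L H.

Lemma tr_join_trans L K H : tr_join L K -> tr_join K H -> tr_join L H.
Proof.
move=> LK; elim: LK H => {L K} // T L K H TR TLK _ IH J HJ.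
exact: tr_join_step TLK (IH _ HJ).
Qed.

Lemma tr_join_sub K H : tr_join K H -> K \subset H.
Proof.
by elim=> {K H} // T L K H _ TLK _; apply: subset_trans; exact: tr_sub TLK.
Qed.

Program Definition tr_largest : transfer_system gT :=
  @TransferSystem gT tr_join tr_join_refl tr_join_trans _ tr_join_sub _ _.
Next Obligation.
by move=> K H /tr_join_sub KH /tr_join_sub HK; exact: group_eq_sub.
Qed.
Next Obligation.
move=> K H g; elim=> {K H} [H|T L K H TR TLK _ IH]; first exact: tr_join_refl.
exact: tr_join_step TR (tr_conj g TLK) IH.
Qed.
Next Obligation.
move=> K H L KH; elim: KH L => {K H} [H|T J K H TR TJK KH IH] L LH.
  have -> : (L :&: H)%G = L by apply/val_inj/setIidPl.
  exact: tr_join_refl.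
apply: tr_join_trans (IH L LH).
have -> : (L :&: J)%G = ((L :&: K) :&: J)%G.
  by apply: val_inj; rewrite /= -setIA (setIidPr (tr_sub TJK)).
apply: (tr_join_step TR) (tr_join_refl _).
by apply: tr_res TJK _; exact: subsetIr.
Qed.

Lemma tr_leastP : tr_le R (fun K H => K \subset H) ->
  tr_le R tr_least /\ forall T : transfer_system gT, tr_le R T -> tr_le tr_least T.
Proof.
move=> Rsub; split=> [K H RKH|T RT K H [_]]; last exact.
by split=> [|T RT]; [exact: Rsub|exact: RT].
Qed.

Lemma tr_largestP :
  (forall H, R H H) -> (forall L K H, R L K -> R K H -> R L H) ->
  tr_le tr_largest R /\ forall T : transfer_system gT, tr_le T R -> tr_le T tr_largest.
Proof.
move=> R1 R2; split=> [K H|T TR K H TKH].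
  elim=> {K H} // T L K H TR TLK _; apply: R2; exact: TR.
exact: tr_join_step TR TKH (tr_join_refl _).
Qed.

End LeastLargest.

Section TransferFunctors.

Context (gT gT' : finGroupType) (f : {morphism [set: gT] >-> gT'}).

Definition fL_rel (T : transfer_system gT') (K H : {group gT}) : Prop :=
  exists K' H' : {group gT'}, [/\ T K' H', K = (f @*^-1 K')%G & H = (f @*^-1 H')%G].

Definition fR_rel (T : transfer_system gT) (K' H' : {group gT'}) : Prop :=
  K' \subset H' /\ T (f @*^-1 K')%G (f @*^-1 H')%G.

Definition fL (T : transfer_system gT') : transfer_system gT := tr_least (fL_rel T).
Definition fR (T : transfer_system gT) : transfer_system gT' := tr_largest (fR_rel T).

Lemma fLP T : tr_le (fL_rel T) (fL T)
  /\ forall S : transfer_system gT, tr_le (fL_rel T) S -> tr_le (fL T) S.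
Proof.
by apply: tr_leastP => K H [K' [H' [/tr_sub KH -> ->]]]; exact: morphpreS.
Qed.

Lemma fRP T : tr_le (fR T) (fR_rel T)
  /\ forall S : transfer_system gT', tr_le S (fR_rel T) -> tr_le S (fR T).
Proof.
apply: tr_largestP => [H|L K H [LK TLK] [KH TKH]]; first by split=> //; exact: tr_refl.
by split; [exact: subset_trans KH|exact: tr_trans TLK TKH].
Qed.

Lemma fL_mono (S T : transfer_system gT') : tr_le S T -> tr_le (fL S) (fL T).
Proof.
move=> ST; apply: (fLP S).2 => K H [K' [H' [SKH -> ->]]].
by apply: (fLP T).1; exists K', H'; split=> //; exact: ST.
Qed.

Lemma fR_mono (S T : transfer_system gT) : tr_le S T -> tr_le (fR S) (fR T).
Proof.
move=> ST; apply: (fRP T).2 => K H /(fRP S).1[KH SKH]; split=> //; exact: ST.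
Qed.

Program Definition fL_functor : functor (Tr gT') (Tr gT) :=
  @Functor (Tr gT') (Tr gT) fL fL_mono _ _.
Next Obligation. by move=> *; exact: Tr_thin. Qed.
Next Obligation. by move=> *; exact: Tr_thin. Qed.

Program Definition fR_functor : functor (Tr gT) (Tr gT') :=
  @Functor (Tr gT) (Tr gT') fR fR_mono _ _.
Next Obligation. by move=> *; exact: Tr_thin. Qed.
Next Obligation. by move=> *; exact: Tr_thin. Qed.

End TransferFunctors.

(* H/K is the H-set of left cosets, enumerated by enum_val; [coset_graph K H] is
   Gamma(H/K), the graph of the resulting permutation representation. *)
Definition coset_enum (gT : finGroupType) (K H : {group gT}) (i : 'I_#|H : K|) :
    {set gT} :=
  enum_val (cast_ord (esym (card_lcosets H K)) i).

Definition coset_graph (gT : finGroupType) (K H : {group gT}) :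
    {set gT * Sigma #|H : K|} :=
  [set p : gT * Sigma #|H : K| | (p.1 \in H)
     && [forall i, coset_enum (p.2 i) == p.1 *: coset_enum i]].

Definition arrow (gT : finGroupType) (O : goperad gT) (K H : {group gT}) : Prop :=
  K \subset H /\ has_fixed O (coset_graph K H).

(* Operations of O whose inputs are labelled by elements of a type. *)
Section Labelled.

Context (gT : finGroupType) (O : goperad gT).

Record lab (T : Type) := Lab { lab_n : nat; lab_op : O lab_n; lab_e : 'I_lab_n -> T }.
Arguments Lab {T lab_n} _ _.
Arguments lab_e {T} _ _.

Lemma lab_eq (T : Type) m (y : O m) (e : 'I_m -> T) n (z : O n) (d : 'I_n -> T) :
  y =[O]= z -> (forall (i : 'I_m) (j : 'I_n), i = j :> nat -> e i = d j) -> Lab y e = Lab z d.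
Proof.
move=> yz; have emn : m = n := congr1 (@projT1 _ _) yz.
case: _ / emn in z d yz *; rewrite (sigT_inj yz) => ed.
by congr Lab; apply: funext => i; exact: ed.
Qed.

Lemma Lab_inj (T : Type) n (y z : O n) (e d : 'I_n -> T) :
  Lab y e = Lab z d -> y = z /\ e =1 d.
Proof.
pose P m := (O m * ('I_m -> T))%type.
pose tot (l : lab T) := existT P (lab_n l) (lab_op l, lab_e l).
by move=> /(congr1 tot) /(@sigT_inj _ P n _ _) [-> ->].
Qed.

(* Relabelling along a bijection. *)
Definition same (T : Type) (l l' : lab T) : Prop :=
  exists b : Sigma (lab_n l), l' = Lab (sact (lab_op l) b) (lab_e l \o b).

Lemma same_refl T (l : lab T) : same l l.
Proof.
exists 1; case: l => n y e /=; rewrite sact1; congr Lab.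
by apply: funext => i /=; rewrite Sigma_1E.
Qed.

Lemma same_trans T (l l' l'' : lab T) : same l l' -> same l' l'' -> same l l''.
Proof.
move=> [b ->] [c ->]; exists (b * c); rewrite /= sactM; congr Lab.
by apply: funext => i /=; rewrite Sigma_mulE.
Qed.

Lemma same_sym T (l l' : lab T) : same l l' -> same l' l.
Proof.
move=> [b ->]; exists b^-1 => /=; rewrite -sactM mulgV sact1; case: l b => n y e b /=.
by congr Lab; apply: funext => i /=; rewrite -Sigma_mulE mulgV Sigma_1E.
Qed.

Definition lab_gact T (g : gT) (l : lab T) : lab T := Lab (gact g (lab_op l)) (lab_e l).
Definition lab_map T T' (h : T -> T') (l : lab T) : lab T' :=
  Lab (lab_op l) (h \o lab_e l).

Lemma same_gact T g (l l' : lab T) : same l l' -> same (lab_gact g l) (lab_gact g l').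
Proof. by move=> [b ->]; exists b; rewrite /lab_gact /= gact_sact. Qed.

Lemma same_map T T' (h : T -> T') (l l' : lab T) :
  same l l' -> same (lab_map h l) (lab_map h l').
Proof. by move=> [b ->]; exists b. Qed.

Lemma same_inv T n (y z : O n) (e d : 'I_n -> T) :
  same (Lab y e) (Lab z d) -> exists b : Sigma n, z = sact y b /\ d =1 e \o b.
Proof. by move=> [b /Lab_inj[-> ed]]; exists b. Qed.

Lemma same_intro T n (y z : O n) (e d : 'I_n -> T) (b : Sigma n) :
  z = sact y b -> (forall i, d i = e (b i)) -> same (Lab y e) (Lab z d).
Proof. by move=> -> ed; exists b; congr Lab; exact: funext. Qed.

(* gamma(x; y) for a family y of labelled operations *)
Definition tot T n (k : 'I_n -> nat) (e : forall i, 'I_(k i) -> T)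
    (u : 'I_(\sum_i k i)) : T :=
  e (tagnat.sig1 u) (tagnat.sig2 u).

Lemma tot_Rank T n (k : 'I_n -> nat) (e : forall i, 'I_(k i) -> T) i j :
  tot e (tagnat.Rank i j) = e i j.
Proof.
pose te (p : {i & 'I_(k i)}) := e (tag p) (tagged p).
have totE u : tot e u = te (tagnat.sig u) by rewrite /tot [in RHS]tagnat.sigE12.
by rewrite totE /tagnat.Rank tagnat.rankK.
Qed.

Definition lab_gamma T n (x : O n) (l : 'I_n -> lab T) : lab T :=
  Lab (gamma x (fun i => lab_op (l i))) (tot (fun i => lab_e (l i))).

Lemma same_inner T n (x : O n) (l l' : 'I_n -> lab T) :
  (forall i, same (l i) (l' i)) -> same (lab_gamma x l) (lab_gamma x l').
Proof.
move=> ll'; pose b i := sval (cid (ll' i)); have lb i := svalP (cid (ll' i)).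
have {lb} -> : l' = fun i => Lab (sact (lab_op (l i)) (b i)) (lab_e (l i) \o b i).
  exact: funext.
exists (sum_perm b); rewrite /lab_gamma /= gamma_sact_inner; congr Lab.
by apply: funext => u /=; rewrite mk_SigmaE tot_Rank.
Qed.

Lemma same_outer T n (x : O n) (l : 'I_n -> lab T) (s : Sigma n) :
  same (lab_gamma x l) (lab_gamma (sact x s) (l \o s)).
Proof.
exists (block_perm (fun i => lab_n (l i)) s); apply: lab_eq.
  exact: (gamma_sact_outer x (fun i => lab_op (l i)) s).
move=> v u uv /=; rewrite mk_SigmaE /block_perm_fun tot_Rank.
by have -> : cast_ord (block_eq (fun i => lab_n (l i)) s) u = v by exact: val_inj.
Qed.

Lemma lab_gact_gamma T n (x : O n) (l : 'I_n -> lab T) g :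
  lab_gact g (lab_gamma x l) = lab_gamma (gact g x) (fun i => lab_gact g (l i)).
Proof. by rewrite /lab_gact /lab_gamma /= gact_gamma. Qed.

Lemma lab_map_gamma T T' (h : T -> T') n (x : O n) (l : 'I_n -> lab T) :
  lab_map h (lab_gamma x l) = lab_gamma x (fun i => lab_map h (l i)).
Proof. by []. Qed.

Lemma lab_gactM T g h (l : lab T) : lab_gact (g * h) l = lab_gact g (lab_gact h l).
Proof. by rewrite /lab_gact /= gactM. Qed.

(* l is an enumeration of X *)
Definition lab_on (T : finType) (X : {set T}) (l : lab T) : Prop :=
  injective (lab_e l) /\ forall t, t \in X <-> exists i, lab_e l i = t.

Lemma same_on (T : finType) (X : {set T}) l l' : same l l' -> lab_on X l -> lab_on X l'.
Proof.
move=> [b ->] [linj lX]; split=> [i j /linj /Sigma_inj //|t] /=.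
rewrite lX; split=> -[i <-]; last by exists (b i).
by exists (b^-1 i); rewrite -Sigma_mulE mulgV Sigma_1E.
Qed.

(* [adm H X a]: the H-set X, with action a, is admissible for O, i.e. O has a
   fixed point for the graph of a permutation representation of X. *)
Definition adm (H : {set gT}) (T : finType) (X : {set T}) (a : gT -> T -> T) : Prop :=
  exists2 l : lab T, lab_on X l & {in H, forall h, same l (lab_gact h (lab_map (a h) l))}.

Lemma adm_transport (T T' : finType) (H H' : {set gT}) (X : {set T})
    (a : gT -> T -> T) (a' : gT -> T' -> T') (h : T -> T') (g : gT) :
  {in X &, injective h} ->
  {in H', forall k, g^-1 * k * g \in H
     /\ {in X, forall t, h (a (g^-1 * k * g) t) = a' k (h t)}} ->
  adm H X a -> adm H' (h @: X) a'.
Proof.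
move=> hinj H'H [l [linj lX] lH]; exists (lab_gact g (lab_map h l)).
  split=> [i j /hinj e|t] /=.
    by apply/linj/e; apply/lX; [exists i|exists j].
  split=> [/imsetP[u /lX[i <-] ->]|[i <-]]; first by exists i.
  by apply/imsetP; exists (lab_e l i) => //; apply/lX; exists i.
move=> k kH'; have [kH hk] := H'H k kH'.
have := same_gact g (same_map h (lH _ kH)).
rewrite /lab_gact /lab_map /= -!gactM !mulgA mulgV mul1g.
have -> // : h \o (a (g^-1 * k * g) \o lab_e l) = a' k \o (h \o lab_e l).
by apply: funext => i /=; apply: hk; apply/lX; exists i.
Qed.

Lemma adm_total (T T' : finType) (H : {group gT}) (X : {set T}) (Z : {set T'})
    (a : gT -> T -> T) (a' : gT -> T' -> T') (p : T' -> T) :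
  {in H, forall h t, t \in X -> a h t \in X} ->
  {in X, forall t, a 1 t = t} ->
  {in H &, forall g h, {in X, forall t, a (g * h) t = a g (a h t)}} ->
  {in H, forall h t, t \in Z -> a' h t \in Z} ->
  {in Z, forall t, a' 1 t = t} ->
  {in H &, forall g h, {in Z, forall t, a' (g * h) t = a' g (a' h t)}} ->
  {in Z, forall t, p t \in X} ->
  {in H, forall h, {in Z, forall t, p (a' h t) = a h (p t)}} ->
  adm H X a ->
  {in X, forall t, adm [set h in H | a h t == t] [set z in Z | p z == t] a'} ->
  adm H Z a'.
Proof.
move=> aX a1 aM aZ a'1 a'M pX pa [x [xinj xX] xH] admF.
pose orb t := [set a h t | h in H].
pose rep t := odflt t [pick s in orb t].
have orbS t h : t \in X -> h \in H -> orb (a h t) = orb t.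
  move=> tX hH; apply/setP => s; apply/imsetP/imsetP => -[k kH ->].
    by exists (k * h); rewrite ?groupM // aM.
  exists (k * h^-1); first by rewrite groupM ?groupV.
  by rewrite -aM ?groupM ?groupV // mulgKV.
have repP t : t \in X -> exists2 h, h \in H & a h (rep t) = t.
  move=> tX; rewrite /rep; case: pickP => [s /imsetP[h hH ->]|/(_ t)/imsetP[]] /=.
    by exists h^-1; rewrite ?groupV // -aM ?groupV // mulVg a1.
  by exists 1; rewrite ?a1.
have rep_orb t h : t \in X -> h \in H -> rep (a h t) = rep t.
  move=> tX hH; rewrite /rep orbS //; case: pickP => // /(_ t) /imsetP[].
  by exists 1; rewrite ?a1.
have repX t : t \in X -> rep t \in X.
  by move=> tX; rewrite /rep; case: pickP => [s /imsetP[h hH ->]|_] //=; exact: aX.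
have /choice[r rP] t : exists h, t \in X -> h \in H /\ a h (rep t) = t.
  have [/repP[h hH ht]|tX] := boolP (t \in X); first by exists h.
  by exists 1.
have lab0 : inhabited (lab T').
  case: (pselect (exists t, t \in X)) => [[t /admF[l _ _]]|nX]; first exact: inhabits l.
  suff : lab_n x = 0%N.
    case: x {xinj xH} xX nX => [[|n] y e] //= xX nX _; have e0 (i : 'I_0) : T' by case: i.
    exact: inhabits (Lab y e0).
  case: x {xinj xH} xX nX => [[|n] y e] //= xX nX; case: nX.
  by exists (e ord0); apply/xX; exists ord0.
have /choice[d dP] t : exists l : lab T', t \in X ->
    lab_on [set z in Z | p z == t] l
    /\ {in [set h in H | a h t == t], forall h, same l (lab_gact h (lab_map (a' h) l))}.
  have [/admF[l l1 l2]|tX] := boolP (t \in X); first by exists l.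
  by case: lab0 => l; exists l.
pose c t := lab_gact (r t) (lab_map (a' (r t)) (d (rep t))).
have dZ t i : t \in X -> lab_e (d t) i \in Z.
  move=> tX; have [[_ dX] _] := dP t tX.
  have : lab_e (d t) i \in [set z in Z | p z == t] by apply/dX; exists i.
  by rewrite inE => /andP[].
have dp t i : t \in X -> p (lab_e (d t) i) = t.
  move=> tX; have [[_ dX] _] := dP t tX.
  have : lab_e (d t) i \in [set z in Z | p z == t] by apply/dX; exists i.
  by rewrite inE => /andP[_ /eqP].
have cH t h : t \in X -> h \in H ->
    same (c (a h t)) (lab_gact h (lab_map (a' h) (c t))).
  move=> tX hH; have htX := aX h hH t tX.
  have [rH rt] := rP t tX; have [sH st] := rP _ htX.
  rewrite /c (rep_orb t h) // in rt st *; set s := r (a h t) in sH st *.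
  pose k := s^-1 * h * r t.
  have kH : k \in H by rewrite !groupM ?groupV.
  have tX' := repX t tX; have [_ dH] := dP _ tX'.
  have akt : a k (rep t) = rep t.
    rewrite /k aM ?groupM ?groupV // rt aM ?groupV // -[X in a _ X]st.
    by rewrite -aM ?groupV // mulVg a1.
  have {dH} := dH k; rewrite inE kH akt eqxx => /(_ isT) dk.
  have := same_gact s (same_map (a' s) dk).
  rewrite /lab_gact /lab_map /= -!gactM.
  have sk : s * k = h * r t by rewrite /k !mulgA mulgV mul1g.
  have -> : a' s \o (a' k \o lab_e (d (rep t))) = a' h \o (a' (r t) \o lab_e (d (rep t))).
    by apply: funext => i /=; rewrite -!a'M ?sk ?dZ.
  by rewrite sk.
have cp t i : t \in X -> p (lab_e (c t) i) = t.
  move=> tX; have [rH rt] := rP t tX.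
  by rewrite /= pa ?dZ ?repX // dp ?repX.
have eX i : lab_e x i \in X by apply/xX; exists i.
exists (lab_gamma (lab_op x) (fun i => c (lab_e x i))).
  split=> [u v /= uv|z].
    rewrite /tot in uv; apply: tagnat.sig_inj; rewrite [LHS]tagnat.sigE12 [RHS]tagnat.sigE12.
    move: (tagnat.sig1 u) (tagnat.sig2 u) (tagnat.sig1 v) (tagnat.sig2 v) uv.
    move=> i j i' j' e.
    have {}e : lab_e (c (lab_e x i)) j = lab_e (c (lab_e x i')) j' := e.
    have ii' : i = i'.
      by apply: xinj; have := congr1 p e; rewrite (cp _ j (eX i)) (cp _ j' (eX i')).
    case: _ / ii' in j' e *; congr existT.
    have [rH _] := rP _ (eX i); have [[dinj _] _] := dP _ (repX _ (eX i)).
    apply: dinj; move: e => /= /(congr1 (a' (r (lab_e x i))^-1)).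
    by rewrite -!a'M ?groupV ?dZ ?repX // mulVg !a'1 ?dZ ?repX.
  split=> [zZ|[u <-]]; last first.
    rewrite /= /tot /=; set i := tagnat.sig1 u; have [rH _] := rP _ (eX i).
    by apply: aZ => //; apply/dZ/repX/eX.
  have /xX[i ei] := pX z zZ; have piX : p z \in X := pX z zZ.
  have [rH rt] := rP _ piX; have [[_ dX] _] := dP _ (repX _ piX).
  have : a' (r (p z))^-1 z \in [set z0 in Z | p z0 == rep (p z)].
    rewrite inE aZ ?groupV //= pa ?groupV // -[X in a _ X == _]rt.
    by rewrite -aM ?groupV ?repX // mulVg a1 ?repX.
  move/dX; rewrite -ei => -[j dj].
  exists (tagnat.Rank (p_ := fun i => lab_n (c (lab_e x i))) i j).
  rewrite /= tot_Rank /= dj -a'M ?groupV ?ei // mulgV a'1 //.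
move=> h hH; have [b /Lab_inj[xb eb]] := xH h hH.
rewrite lab_map_gamma lab_gact_gamma xb.
apply: same_trans (same_outer _ _ b) _; apply: same_inner => i /=.
by rewrite -[lab_e x (b i)]eb; exact: cH.
Qed.

Lemma adm_sub (c : O 0) (T T' : finType) (H : {group gT}) (X : {set T}) (Z : {set T'})
    (a : gT -> T -> T) (a' : gT -> T' -> T') (p : T' -> T) :
  (forall g, gact g c = c) ->
  {in H, forall h t, t \in X -> a h t \in X} ->
  {in X, forall t, a 1 t = t} ->
  {in H &, forall g h, {in X, forall t, a (g * h) t = a g (a h t)}} ->
  {in H, forall h t, t \in Z -> a' h t \in Z} ->
  {in Z, forall t, a' 1 t = t} ->
  {in H &, forall g h, {in Z, forall t, a' (g * h) t = a' g (a' h t)}} ->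
  {in Z, forall t, p t \in X} ->
  {in H, forall h, {in Z, forall t, p (a' h t) = a h (p t)}} ->
  {in Z &, injective p} ->
  adm H X a -> adm H Z a'.
Proof.
move=> cG aX a1 aM aZ a'1 a'M pX pa pinj admX.
apply: (adm_total aX a1 aM aZ a'1 a'M pX pa admX) => t tX.
have [z /andP[zZ /eqP pz]|nZ] := pickP [pred z | (z \in Z) && (p z == t)].
  exists (Lab op_unit (fun=> z)) => [|h].
    split=> [i j|y]; first by rewrite [i]ord1 [j]ord1.
    rewrite !inE; split=> [/andP[yZ /eqP py]|[_ /= <-]]; last by rewrite zZ pz /=.
    by exists ord0; apply: pinj => //; rewrite pz py.
  rewrite inE => /andP[hH /eqP ht]; apply: (same_intro (b := 1)) => /= [|i].
    by rewrite sact1 gact_unit.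
  by apply: pinj => //; rewrite ?aZ // pa // pz.
have f0 : 'I_0 -> T' by case.
exists (Lab c f0) => [|h _].
  split=> [[]//|y]; rewrite !inE; split=> [yZ|[[]//]].
  by have := nZ y; rewrite /= yZ.
apply: (same_intro (b := 1)) => /= [|[]//].
by rewrite sact1 cG.
Qed.

Lemma coset_enum_inj (K H : {group gT}) : injective (@coset_enum gT K H).
Proof. by move=> i j /enum_val_inj /cast_ord_inj. Qed.

Lemma coset_enumP (K H : {group gT}) A :
  A \in lcosets K H <-> exists i, @coset_enum gT K H i = A.
Proof.
split=> [AHK|[i <-]]; last exact: enum_valP.
exists (cast_ord (card_lcosets H K) (enum_rank_in AHK A)).
by rewrite /coset_enum cast_ordK enum_rankK_in.
Qed.

Lemma lcosets_stable (K H : {group gT}) h A :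
  h \in H -> A \in lcosets K H -> h *: A \in lcosets K H.
Proof.
move=> hH /lcosetsP[x xH ->]; apply/lcosetsP; exists (h * x); rewrite ?groupM //.
by rewrite lcosetM.
Qed.

Lemma coset_permP (K H : {group gT}) h : h \in H ->
  exists s : Sigma #|H : K|, forall i, coset_enum (s i) = h *: @coset_enum gT K H i.
Proof.
move=> hH.
have /choice[s sP] i : exists j, @coset_enum gT K H j = h *: @coset_enum gT K H i.
  by apply/coset_enumP/lcosets_stable => //; apply/coset_enumP; exists i.
have sinj : injective s.
  by move=> i j e; apply/(@coset_enum_inj K H)/(@lcoset_inj _ h); rewrite -!sP e.
by exists (mk_Sigma sinj) => i; rewrite mk_SigmaE.
Qed.

Lemma arrow_adm (K H : {group gT}) :
  has_fixed O (coset_graph K H) <-> adm H (lcosets K H) (fun h A => h *: A).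
Proof.
split=> [[x xP]|[[n x e] [/= einj eP] xH]].
  exists (Lab x (@coset_enum gT K H)) => [|h hH].
    by split; [exact: coset_enum_inj|exact: coset_enumP].
  have [s sP] := coset_permP K hH.
  apply: (same_intro (b := s)) => [|i]; last by rewrite sP.
  have hs : (h, s) \in coset_graph K H.
    by rewrite inE hH; apply/forallP => i; rewrite sP.
  by rewrite /= -{2}(xP _ hs) /gsact /= gact_sact -sactM mulVg sact1.
have /choice[b bP] i : exists j, e j = @coset_enum gT K H i.
  by apply/eP/coset_enumP; exists i.
have en : n = #|H : K|.
  have <- : #|lcosets K H| = #|H : K| := card_lcosets H K.
  have -> : lcosets K H = [set e i | i in 'I_n].
    apply/setP => A; apply/idP/imsetP => [/eP[i <-]|[i _ ->]]; first by exists i.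
    by apply/eP; exists i.
  by rewrite card_imset // card_ord.
case: _ / (esym en) in x e einj eP xH b bP *.
have binj : injective b.
  by move=> i j e'; apply: (@coset_enum_inj K H); rewrite -!bP e'.
exists (sact x (mk_Sigma binj)) => -[h s]; rewrite inE /= => /andP[hH /forallP sP].
have [t [/= xt et]] := same_inv (xH h hH).
have tb : t * mk_Sigma binj = mk_Sigma binj * s.
  apply: Sigma_ext => i; rewrite !Sigma_mulE !mk_SigmaE; apply: einj.
  by rewrite bP (eqP (sP i)) -bP; exact/esym/et.
by rewrite /gsact /= !gact_sact xt -!sactM mulgA tb mulgK.
Qed.

Lemma adm_coset_refl (H : {group gT}) : adm H (lcosets H H) (fun h A => h *: A).
Proof.
exists (Lab op_unit (fun=> H : {set gT})) => [|h hH].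
  split=> [i j|A]; first by rewrite [i]ord1 [j]ord1.
  split=> [/lcosetsP[x xH ->]|[_ /= <-]]; first by exists ord0; rewrite /= lcoset_id.
  by apply/lcosetsP; exists 1; rewrite ?mul1g ?lcoset1.
by apply: (same_intro (b := 1)) => /= [|i]; rewrite ?sact1 ?gact_unit // lcoset_id.
Qed.

Lemma adm_coset_conj (K H : {group gT}) g :
  adm H (lcosets K H) (fun h A => h *: A) ->
  adm (H :^ g^-1) (lcosets (K :^ g^-1)%G (H :^ g^-1)) (fun h A => h *: A).
Proof.
have conjL x (A : {set gT}) y : (x *: A) :^ y = x ^ y *: (A :^ y).
  by rewrite conjsMg conjg_set1.
have -> : lcosets (K :^ g^-1)%G (H :^ g^-1) = (fun A => A :^ g^-1) @: lcosets K H.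
  apply/setP => A; apply/lcosetsP/imsetP => [[x /imsetP[y yH ->] ->]|[B /lcosetsP[x xH ->] ->]].
    by exists (y *: K); [apply/lcosetsP; exists y|rewrite conjL].
  by exists (x ^ g^-1); rewrite ?memJ_conjg ?conjL.
apply: (adm_transport (g := g)) => [A B _ _ /conjsg_inj//|k].
rewrite mem_conjgV => kH; have -> : g^-1 * k * g = k ^ g by rewrite conjgE mulgA.
by split=> // A _; rewrite conjL conjgK.
Qed.

Lemma lcoset_mulG (K : {group gT}) (L : {set gT}) x : (x *: L) * K = x *: (L * K).
Proof. by rewrite mulgA. Qed.

Lemma adm_coset_trans (L K H : {group gT}) : L \subset K -> K \subset H ->
  adm K (lcosets L K) (fun h A => h *: A) ->
  adm H (lcosets K H) (fun h A => h *: A) ->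
  adm H (lcosets L H) (fun h A => h *: A).
Proof.
move=> LK KH admLK admKH.
have LKK : (L : {set gT}) * K = K by exact: mulSGid.
apply: (adm_total (p := fun A => A * K) _ _ _ _ _ _ _ _ admKH).
- by move=> h hH A; exact: lcosets_stable.
- by move=> A _; rewrite lcoset1.
- by move=> g h _ _ A _; rewrite lcosetM.
- by move=> h hH A; exact: lcosets_stable.
- by move=> A _; rewrite lcoset1.
- by move=> g h _ _ A _; rewrite lcosetM.
- move=> A /lcosetsP[x xH ->]; rewrite lcoset_mulG LKK.
  by apply/lcosetsP; exists x.
- by move=> h _ A _; rewrite lcoset_mulG.
move=> A /lcosetsP[x xH ->].
have -> : [set B in lcosets L H | B * K == x *: K] = (fun B => x *: B) @: lcosets L K.
  apply/setP => B; rewrite inE; apply/andP/imsetP.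
    case=> /lcosetsP[y yH ->]; rewrite lcoset_mulG LKK => /eqP yx.
    have yxK : x^-1 * y \in K by rewrite -mem_lcoset -yx lcoset_refl.
    exists ((x^-1 * y) *: L); first by apply/lcosetsP; exists (x^-1 * y).
    by rewrite -lcosetM mulKVg.
  case=> _ /lcosetsP[y yK ->] ->; rewrite -lcosetM lcoset_mulG LKK.
  split; last by rewrite lcosetM lcoset_id.
  by apply/lcosetsP; exists (x * y); rewrite // groupM // (subsetP KH).
apply: (adm_transport (g := x)) admLK => [B C _ _ /lcoset_inj//|k].
rewrite inE => /andP[kH /eqP]; rewrite -lcosetM => kxK; split.
  by rewrite -mulgA -mem_lcoset -kxK lcoset_refl.
by move=> B _; rewrite -!lcosetM -mulgA mulKVg.
Qed.

Lemma adm_coset_res (c : O 0) (K H L : {group gT}) : (forall g, gact g c = c) ->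
  L \subset H ->
  adm H (lcosets K H) (fun h A => h *: A) ->
  adm L (lcosets (L :&: K)%G L) (fun h A => h *: A).
Proof.
move=> cG LH admKH; have lH h : h \in L -> h \in H := subsetP LH h.
have LKK : (L :&: K) * K = K by exact/mulSGid/subsetIr.
have admL : adm L (lcosets K H) (fun h A => h *: A).
  rewrite -[lcosets K H]imset_id; apply: (adm_transport (g := 1)) admKH => // k kL.
  by rewrite invg1 mul1g mulg1; split=> //; exact: lH.
apply: (adm_sub (p := fun A => A * K) cG _ _ _ _ _ _ _ _ _ admL).
- by move=> h /lH hH A; exact: lcosets_stable.
- by move=> A _; rewrite lcoset1.
- by move=> g h _ _ A _; rewrite lcosetM.
- by move=> h hL A; exact: lcosets_stable.
- by move=> A _; rewrite lcoset1.
- by move=> g h _ _ A _; rewrite lcosetM.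
- move=> A /lcosetsP[x /lH xH ->]; rewrite lcoset_mulG LKK.
  by apply/lcosetsP; exists x.
- by move=> h _ A _; rewrite lcoset_mulG.
move=> _ _ /lcosetsP[x xL ->] /lcosetsP[y yL ->]; rewrite !lcoset_mulG !LKK => xy.
apply/lcoset_eqP; rewrite mem_lcoset inE groupM ?groupV //=.
by rewrite -mem_lcoset -xy lcoset_refl.
Qed.

End Labelled.

Lemma arrow_conj (gT : finGroupType) (O : goperad gT) (K H : {group gT}) g :
  arrow O K H -> arrow O (K :^ g^-1)%G (H :^ g^-1)%G.
Proof.
move=> [KH /arrow_adm adKH]; split; first by rewrite conjSg.
exact/arrow_adm/adm_coset_conj.
Qed.

Program Definition arrow_transfer (gT : finGroupType) (O : NOp gT) :
    transfer_system gT :=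
  @TransferSystem gT (arrow O) _ _ _ _ (@arrow_conj gT O) _.
Next Obligation.
by move=> gT O H; split=> //; exact/arrow_adm/adm_coset_refl.
Qed.
Next Obligation.
move=> gT O L K H [LK /arrow_adm adLK] [KH /arrow_adm adKH].
split; first exact: subset_trans KH.
exact/arrow_adm/(adm_coset_trans LK KH).
Qed.
Next Obligation. by move=> gT O K H [KH _] [HK _]; exact: group_eq_sub. Qed.
Next Obligation. by move=> gT O K H []. Qed.
Next Obligation.
move=> gT O K H L [KH /arrow_adm adKH] LH; split; first exact: subsetIl.
have [_ [c cG]] := full_valP O 0.
exact/arrow_adm/(adm_coset_res cG LH).
Qed.

Section GraphSubgroups.

Context (gT : finGroupType).

Fact graph_group_set n (H : {group gT}) (s : {morphism H >-> Sigma n}) :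
  group_set [set (h, s h) | h in H].
Proof.
apply/group_setP; split.
  by apply/imsetP; exists 1; rewrite ?morph1.
move=> _ _ /imsetP[g gH ->] /imsetP[h hH ->].
by apply/imsetP; exists (g * h); rewrite ?groupM // morphM.
Qed.

Definition graph_group n (H : {group gT}) (s : {morphism H >-> Sigma n}) :
    {group gT * Sigma n} := group (graph_group_set s).

Lemma graph_groupP n (H : {group gT}) (s : {morphism H >-> Sigma n}) :
  graph_subgroup (graph_group s).
Proof. by exists H, s. Qed.

Lemma graph_fixed (O : goperad gT) n (H : {group gT}) (s : {morphism H >-> Sigma n})
    (A : {set gT * Sigma n}) (x : O n) : A = [set (h, s h) | h in H] ->
  is_fixed A x <-> {in H, forall h, gact h x = sact x (s h)}.
Proof.
move=> ->; split=> [xA h hH|xH _ /imsetP[h hH ->]].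
  have := xA (h, s h); rewrite /gsact gact_sact /= => {2}<-; last exact: imset_f.
  by rewrite -sactM mulVg sact1.
by rewrite /gsact gact_sact /= xH // -sactM mulgV sact1.
Qed.

Lemma graph_group_fixed (O : goperad gT) n (H : {group gT})
    (s : {morphism H >-> Sigma n}) (x : O n) :
  is_fixed (graph_group s) x <-> {in H, forall h, gact h x = sact x (s h)}.
Proof. exact: graph_fixed. Qed.

Section CosetGraph.

Context (K H : {group gT}).

Definition coset_perm (h : gT) : Sigma #|H : K| :=
  odflt 1 [pick s : Sigma #|H : K| | [forall i, coset_enum (s i) == h *: coset_enum i]].

Lemma coset_permE h i : h \in H -> coset_enum (coset_perm h i) = h *: @coset_enum gT K H i.
Proof.
move=> hH; rewrite /coset_perm; case: pickP => [s /forallP/(_ i)/eqP //|].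
have [s sP] := coset_permP K hH => /(_ s) /negP[].
by apply/forallP => j; rewrite sP.
Qed.

Fact coset_permM : {in H &, {morph coset_perm : g h / g * h}}.
Proof.
move=> g h gH hH; apply: Sigma_ext => i; apply: coset_enum_inj.
by rewrite Sigma_mulE !coset_permE ?groupM // lcosetM.
Qed.

Definition coset_morphism : {morphism H >-> Sigma #|H : K|} := Morphism coset_permM.

Lemma coset_graphE : coset_graph K H = [set (h, coset_morphism h) | h in H].
Proof.
apply/setP => -[h s]; rewrite inE /=; apply/andP/imsetP.
  case=> hH /forallP sP; exists h => //; congr pair; apply: Sigma_ext => i.
  by apply: coset_enum_inj; rewrite (eqP (sP i)) coset_permE.
case=> g gH [-> ->]; split=> //; apply/forallP => i.
by rewrite coset_permE.
Qed.

End CosetGraph.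

End GraphSubgroups.

Lemma arrow_hom (gT : finGroupType) (O P : goperad gT) (u : gophom O P) :
  tr_le (arrow O) (arrow P).
Proof.
move=> K H [KH [x xA]]; split=> //; exists (u _ x) => p pA.
by rewrite /gsact -gohom_sact -gohom_gact; congr (u _ _); exact: xA.
Qed.

Lemma arrow_weq (gT : finGroupType) (O P : goperad gT) (u : gophom O P) :
  weq u -> tr_le (arrow P) (arrow O).
Proof.
move=> wu K H [KH fP]; split=> //; move: fP; rewrite coset_graphE.
exact: (wu _ _ (graph_groupP (coset_morphism K H))).
Qed.

Definition weqN (gT : finGroupType) : hom_class (NOp gT) := fun O P u => weq u.

Definition HoNOp (gT : finGroupType) : category := localization (@weqN gT).

Program Definition arrow_functor (gT : finGroupType) : functor (NOp gT) (Tr gT) :=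
  @Functor (NOp gT) (Tr gT) (@arrow_transfer gT) (fun O P u => arrow_hom u) _ _.
Next Obligation. by move=> *; exact: Tr_thin. Qed.
Next Obligation. by move=> *; exact: Tr_thin. Qed.

Lemma arrow_inverts (gT : finGroupType) : inverts (@weqN gT) (arrow_functor gT).
Proof.
move=> O P u wu; have PO := @arrow_weq gT _ _ (u : gophom (full_val O) (full_val P)) wu.
by exists (PO : @hom (Tr gT) (arrow_transfer P) (arrow_transfer O)); exact: Tr_thin.
Qed.

Definition Ho_arrow (gT : finGroupType) : functor (HoNOp gT) (Tr gT) :=
  loc_lift (@arrow_inverts gT).

Section HoResCoind.

Context (gT gT' : finGroupType) (f : {morphism [set: gT] >-> gT'}).

Lemma res_weq (O P : NOp gT') (u : @hom (NOp gT') O P) :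
  weqN u -> weqN (fmap (res_N f) u).
Proof.
move=> wu n A [H [s sA]] [x /(graph_fixed x sA)/= xH].
have [Pfree _] := full_valP P n.
have s1 h : h \in H -> f h = 1 -> s h = 1.
  by move=> hH fh; apply: (Pfree x); rewrite -xH // fh gact1.
pose r k := odflt 1 [pick h | (h \in H) && (f h == k)].
have rH k : r k \in H by rewrite /r; case: pickP => [h /andP[]|] //= _; exact: group1.
have rf h : h \in H -> s (r (f h)) = s h.
  move=> hH; have fr : f (r (f h)) = f h.
    rewrite /r; case: pickP => [g /andP[_ /eqP]|/(_ h)] //.
    by rewrite hH eqxx.
  have : s ((r (f h))^-1 * h) = 1.
    apply: s1; first by rewrite groupM ?groupV.
    by rewrite morphT morphV ?inE // fr mulVg.
  by rewrite morphM ?groupV // morphV // => /eqP; rewrite -eq_mulVg1 => /eqP.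
have s'M : {in f @* H &, {morph (fun k => s (r k)) : g h / g * h}}.
  move=> _ _ /morphimP[g _ gH ->] /morphimP[h _ hH ->].
  by rewrite -morphT !rf ?groupM // morphM.
pose s' := Morphism s'M.
have /(wu n _ (graph_groupP s'))[y /graph_group_fixed yH] :
    has_fixed (P : goperad gT') (graph_group s').
  exists x; apply/graph_group_fixed => _ /morphimP[h _ hH ->] /=.
  by rewrite rf // xH.
exists y; apply/(graph_fixed (y : res f O n) sA) => h hH /=.
by rewrite yH ?mem_morphim ?inE //= rf.
Qed.

Lemma coind_fixed (O : goperad gT) n (H : {group gT'}) (s : {morphism H >-> Sigma n}) :
  (forall x : gT', exists y : O n,
     forall g, (f g) ^ x \in H -> gact g y = sact y (s ((f g) ^ x))) ->
  exists p : coind f O n, {in H, forall h, gact h p = sact p (s h)}.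
Proof.
move=> /choice[y yP].
pose dc z := [set f g * z * h | g in [set: gT], h in H].
pose rep z := odflt 1 [pick w in dc z].
have dcS z g h : h \in H -> dc (f g * z * h) = dc z.
  move=> hH; apply/setP => w; apply/imset2P/imset2P => -[a b _ bH ->].
    by exists (a * g) (h * b); rewrite ?inE ?groupM // morphT !mulgA.
  exists (a * g^-1) (h^-1 * b); rewrite ?inE ?groupM ?groupV //.
  by rewrite morphT morphV ?inE // !mulgA mulgKV mulgK.
have repP z : exists gh : gT * gT', gh.2 \in H /\ z = f gh.1 * rep z * gh.2.
  rewrite /rep; case: pickP => [w /imset2P[g h _ hH ->]|/(_ z)/imset2P[]] /=.
    exists (g^-1, h^-1); rewrite groupV; split=> //=.
    by rewrite morphV ?inE // !mulgA mulVg mul1g mulgK.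
  by exists 1 1; rewrite ?inE // morph1 mul1g mulg1.
have {repP} /choice[c cP] := repP.
pose p z := gact (c z).1 (sact (y (rep z)) (s (c z).2)).
have key w g h g' h' : h \in H -> h' \in H -> f g * w * h = f g' * w * h' ->
    gact g (sact (y w) (s h)) = gact g' (sact (y w) (s h')).
  move=> hH h'H e.
  have fw : f (g'^-1 * g) ^ w = h' * h^-1.
    rewrite conjgE morphT morphV ?inE //; apply: (mulgI (f g' * w)).
    by rewrite !mulgA mulgK mulgV mul1g -e mulgK.
  have := yP w (g'^-1 * g); rewrite fw groupM ?groupV // => /(_ isT) yw.
  rewrite !gact_sact -[g](mulKVg g') gactM yw gact_sact -sactM.
  by rewrite -morphM ?groupM ?groupV // mulgKV.
have pP z w g h : h \in H -> z = f g * rep w * h -> rep z = rep w ->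
    p z = gact g (sact (y (rep w)) (s h)).
  move=> hH e rz; have [cH cz] := cP z.
  by rewrite /p rz; apply: key => //; rewrite -rz -cz rz.
have repS z g h : h \in H -> rep (f g * z * h) = rep z.
  by move=> hH; rewrite /rep dcS.
have pf g z : p (f g * z) = gact g (p z).
  have [cH cz] := cP z; rewrite /p -gactM -/(p _).
  apply: pP => //; first by rewrite morphT {1}cz !mulgA.
  by rewrite -[f g * z]mulg1 repS.
exists (Coind pf) => h hH; apply: coind_ext => z /=.
have [cH cz] := cP z.
rewrite (pP (z * h) z (c z).1 ((c z).2 * h)) ?groupM //.
- by rewrite /p !gact_sact -sactM -morphM.
- by rewrite {1}cz !mulgA.
- by rewrite -[z]mul1g -(morph1 f) -mulgA -[in RHS](mulg1 (_ * z)) mulgA !repS.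
Qed.

Lemma coind_weq (O P : NOp gT) (u : @hom (NOp gT) O P) :
  weqN u -> weqN (fmap (coind_N f) u).
Proof.
move=> wu n A [H [s sA]] [q /(graph_fixed q sA)/= qH].
have [p pH] : exists p : coind f O n, {in H, forall h, gact h p = sact p (s h)}.
  apply: coind_fixed => x.
  have sxM : {in f @*^-1 (H :^ x^-1) &, {morph (fun g => s ((f g) ^ x)) : g h / g * h}}.
    move=> g h; rewrite !inE /= !mem_conjgV => gH hH.
    by rewrite morphT conjMg morphM.
  have /(wu n _ (graph_groupP (Morphism sxM)))[y /graph_group_fixed yH] :
      has_fixed (P : goperad gT) (graph_group (Morphism sxM)).
    exists (coind_val q x); apply/graph_group_fixed => g.
    rewrite !inE /= mem_conjgV => gH; rewrite -coind_valP.
    have := congr1 (fun p => coind_val p x) (qH _ gH) => /= <-.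
    by rewrite conjgE !mulgA mulgV mul1g.
  exists y => g gH; apply: yH; by rewrite !inE /= mem_conjgV.
by exists p; apply/(graph_fixed p sA).
Qed.

Definition Ho_res : functor (HoNOp gT') (HoNOp gT) := loc_map res_weq.
Definition Ho_coind : functor (HoNOp gT) (HoNOp gT') := loc_map coind_weq.

End HoResCoind.

(* Main.v *)
From mathcomp Require Import all_boot all_order.
From mathcomp Require Import all_fingroup.
From mathcomp Require Import boolp.
Require Import Defs.

(* Both squares land in a poset, so it suffices to compare transfer systems on
   objects.  For res: a fixed point in the Sigma-free operad P forces the elements
   of H killed by f to act trivially on H/K, so that H/K is the f(H)-set f(H)/f(K)
   and K -> H is the restriction to H of f^-1 f(K) -> f^-1 f(H).  For coind: by the
   description of fixed points of a coinduced operad, H'/K' is admissible for coind O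
   as soon as its pullbacks along f and the inner automorphisms of G' are admissible
   for O; these split into orbits, whose stabilisers are the f^-1 of conjugates of K'. *)

Set Implicit Arguments.
Unset Strict Implicit.
Unset Printing Implicit Defensive.

Local Open Scope group_scope.

(** * Admissible orbits and unions of orbits *)

Section Orbits.

Context (gT : finGroupType) (O : goperad gT) (T : finType) (a : gT -> T -> T).
Hypotheses (a1 : forall t, a 1 t = t) (aM : forall g h t, a (g * h) t = a g (a h t)).

Lemma act_invK g : cancel (a g) (a g^-1).
Proof. by move=> t; rewrite -aM mulVg a1. Qed.

Section Stabiliser.

Context (H S : {group gT}) (z : T).
Hypothesis Sz : forall h, h \in H -> (h \in S) = (a h z == z).

(** The orbit map from [H]/[S] to [T] is written with [repr]; since [S] fixes [z], the choice of
    representative does not matter. *)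
Lemma act_repr_lcoset x : S \subset H -> a (repr (x *: S)) z = a x z.
Proof.
move=> SH; have /lcosetP[s sS ->] := mem_repr x (lcoset_refl S x).
by rewrite aM; move: (sS); rewrite Sz ?(subsetP SH) // => /eqP ->.
Qed.

Lemma act_repr_inj : S \subset H ->
  {in lcosets S H &, injective (fun A => a (repr A) z)}.
Proof.
move=> SH _ _ /lcosetsP[x xH ->] /lcosetsP[y yH ->].
rewrite !act_repr_lcoset // => xy; apply/lcoset_eqP.
by rewrite mem_lcoset Sz ?groupM ?groupV // aM xy act_invK.
Qed.

Lemma act_repr_equiv : S \subset H ->
  {in H, forall h, {in lcosets S H, forall A, a (repr (h *: A)) z = a h (a (repr A) z)}}.
Proof.
move=> SH h _ _ /lcosetsP[x xH ->].
by rewrite -lcosetM !act_repr_lcoset // aM.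
Qed.

Lemma adm_orbit : S \subset H ->
  adm O H (lcosets S H) (fun h A => h *: A) -> adm O H [set a h z | h in H] a.
Proof.
move=> SH admS.
have -> : [set a h z | h in H] = (fun A => a (repr A) z) @: lcosets S H.
  apply/setP => t; apply/imsetP/imsetP => [[h hH ->]|[_ /lcosetsP[h hH ->] ->]].
    by exists (h *: S); rewrite ?act_repr_lcoset //; apply/lcosetsP; exists h.
  by exists h; rewrite ?act_repr_lcoset.
apply: (adm_transport (g := 1)) admS => [|k kH]; first exact: act_repr_inj.
by rewrite invg1 mul1g mulg1; split=> // A; exact: act_repr_equiv.
Qed.

(** The orbit of [z] is a copy of [H]/[S] inside [Z]. Plugging the fixed constant [c] into the
    inputs outside the orbit cuts [Z] down to it. *)
Lemma adm_stabiliser (c : O 0) (Z : {set T}) : (forall g, gact g c = c) ->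
  S \subset H -> {in H, forall h t, t \in Z -> a h t \in Z} -> z \in Z ->
  adm O H Z a -> adm O H (lcosets S H) (fun h A => h *: A).
Proof.
move=> cG SH aZ zZ.
apply: (adm_sub (p := fun A => a (repr A) z) cG aZ).
- by move=> t _; exact: a1.
- by move=> g h _ _ t _; exact: aM.
- by move=> h hH A; exact: lcosets_stable.
- by move=> A _; rewrite lcoset1.
- by move=> g h _ _ A _; rewrite lcosetM.
- by move=> _ /lcosetsP[x xH ->]; rewrite act_repr_lcoset // aZ.
- exact: act_repr_equiv.
- exact: act_repr_inj.
Qed.

End Stabiliser.

Lemma adm_trivial (H : {set gT}) (X : {set T}) :
  (exists x : O #|X|, forall g, gact g x = x) -> adm O H X (fun _ t => t).
Proof.
move=> [x xG]; exists (@Lab _ O T #|X| x (@enum_val T (mem X))) => [|h _].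
  split=> [|t]; first exact: enum_val_inj.
  split=> [tX|[i <-]]; last exact: enum_valP.
  by exists (enum_rank_in tX t) => /=; exact: enum_rankK_in.
by apply: (same_intro (b := 1)) => [|i]; rewrite /= ?sact1 ?xG ?Sigma_1E.
Qed.

End Orbits.

(** [Z] lies equivariantly over its set of orbits, on which [H] acts trivially. A [G]-fixed
    operation makes that base admissible, and composing it with operations for the fibres, which are
    the orbits, gives one for [Z]. *)
Lemma adm_orbits (gT : finGroupType) (O : goperad gT) (T : finType)
    (a : gT -> T -> T) (H : {group gT}) (Z : {set T}) :
  (forall n, exists x : O n, forall g, gact g x = x) ->
  (forall t, a 1 t = t) -> (forall g h t, a (g * h) t = a g (a h t)) ->
  {in H, forall h t, t \in Z -> a h t \in Z} ->
  {in Z, forall z, adm O H [set a h z | h in H] a} ->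
  adm O H Z a.
Proof.
move=> ON a1 aM aZ admZ; pose orb z := [set a h z | h in H].
have orb_refl z : z \in orb z by apply/imsetP; exists 1; rewrite ?a1.
have orbS z h : h \in H -> orb (a h z) = orb z.
  move=> hH; apply/setP => t; apply/imsetP/imsetP => -[k kH ->].
    by exists (k * h); rewrite ?groupM // aM.
  by exists (k * h^-1); rewrite ?groupM ?groupV // -aM mulgKV.
have admX := adm_trivial H (ON #|orb @: Z|).
apply: (adm_total _ _ _ aZ _ _ _ _ admX (p := orb)) => //.
- by move=> g h _ _ t _; exact: aM.
- by move=> t tZ; exact: imset_f.
- by move=> h hH t _; exact: orbS.
move=> _ /imsetP[z zZ ->].
have -> : [set h in H | orb z == orb z] = H :> {set gT} by apply/setP => h; rewrite inE eqxx andbT.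
have -> : [set t in Z | orb t == orb z] = orb z; last exact: admZ.
apply/setP => t; rewrite inE; apply/andP/idP => [[_ /eqP <-]//|/imsetP[h hH ->]].
by rewrite aZ // orbS.
Qed.

(** Passes from the enumeration hidden in [adm] to a prescribed one, [d], as needed to obtain fixed
    points of a given graph subgroup. *)
Lemma adm_fixed (gT : finGroupType) (O : goperad gT) (T : finType)
    (a : gT -> T -> T) (H : {set gT}) (X : {set T}) n (d : 'I_n -> T) :
  injective d -> (forall t, t \in X <-> exists i, d i = t) -> adm O H X a ->
  exists y : O n, forall h (s : Sigma n), h \in H ->
    (forall i, d (s i) = a h (d i)) -> gact h y = sact y s.
Proof.
move=> dinj dX [[m x e] [/= einj eX] xH].
have card_enum k (u : 'I_k -> T) : injective u -> (forall t, t \in X <-> exists i, u i = t) ->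
    #|X| = k.
  move=> uinj uX; have -> : X = [set u i | i in 'I_k].
    apply/setP => t; apply/idP/imsetP => [/uX[i <-]|[i _ ->]]; first by exists i.
    by apply/uX; exists i.
  by rewrite card_imset // card_ord.
have mn : m = n by rewrite -(card_enum _ e) // (card_enum _ d).
case: _ / mn in d dinj dX *.
have /choice[b bP] i : exists j, e j = d i by apply/eX/dX; exists i.
have binj : injective b by move=> i j e'; apply: dinj; rewrite -!bP e'.
exists (sact x (mk_Sigma binj)) => h s hH sP.
have [t [/= xt et]] := same_inv (xH h hH).
(* [t] and [s] describe the action of [h] in the enumerations [e] and [d], so the change of
   enumeration [b] intertwines them. *)
have tb : t * mk_Sigma binj = mk_Sigma binj * s.
  apply: Sigma_ext => i; rewrite !Sigma_mulE !mk_SigmaE; apply: einj.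
  by rewrite bP sP -bP; exact/esym/et.
rewrite gact_sact -sactM -tb sactM -xt; congr sact.
Qed.

(** * Transfer systems of restricted and coinduced operads *)

Section Pullback.

Context (gT gT' : finGroupType) (f : {morphism [set: gT] >-> gT'}).

Lemma adm_res (P : goperad gT') (T : finType) (a : gT' -> T -> T)
    (H : {set gT}) (H' : {set gT'}) (X : {set T}) :
  {in H, forall h, f h \in H'} ->
  adm P H' X a -> adm (res f P) H X (fun h => a (f h)).
Proof.
move=> fH [[n y e] eX yH']; exists (@Lab _ (res f P) T n y e) => // h /fH /yH' ye.
have [b [yb eb]] := same_inv ye.
exact: (same_intro (O := res f P) (b := b) yb eb).
Qed.

Lemma adm_res_image (P : goperad gT') (T T' : finType) (a : gT -> T -> T)
    (a' : gT' -> T' -> T') (H : {set gT}) (X : {set T}) (j : T -> T') :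
  {in X &, injective j} ->
  {in H, forall h, {in X, forall t, j (a h t) = a' (f h) (j t)}} ->
  adm (res f P) H X a -> adm P (f @: H) (j @: X) a'.
Proof.
move=> jinj ja [[n y e] [/= einj eX] yH].
have eiX i : e i \in X by apply/eX; exists i.
exists (@Lab _ P T' n y (j \o e)).
  split=> [i k /= /jinj e'|t]; first exact/einj/e'.
  split=> [/imsetP[u /eX[i <-] ->]|[i <-]]; first by exists i.
  by apply/imsetP; exists (e i).
move=> _ /imsetP[h hH ->]; have [b [yb eb]] := same_inv (yH h hH).
apply: (same_intro (b := b)) => //= i.
by rewrite -ja //; congr j; exact: eb.
Qed.

(** Let the preimage of [H'] act on [H']/[K'] through [f]: the pulled-back set stays admissible, and
    the stabiliser of the coset [K'] is the preimage of [K']. *)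
Lemma arrow_res_preim (P : NOp gT') (K' H' : {group gT'}) :
  arrow P K' H' -> arrow (res f P) (f @*^-1 K')%G (f @*^-1 H')%G.
Proof.
move=> [KH /arrow_adm admK]; split; first exact: morphpreS.
have [_ [c cG]] := full_valP P 0.
have fH : {in f @*^-1 H', forall h, f h \in H'} by move=> h /morphpreP[].
apply/arrow_adm.
apply: (@adm_stabiliser _ (res f P) _ (fun h A => f h *: A) _ _ _ _ (K' : {set gT'})
          _ c (lcosets K' H')); last exact: adm_res admK.
- by move=> A; rewrite morph1 lcoset1.
- by move=> g h A; rewrite morphT lcosetM.
- move=> h _; rewrite !inE /=; apply/idP/eqP => [|<-]; first exact: lcoset_id.
  exact: lcoset_refl.
- by move=> g; exact: cG.
- exact: morphpreS.
- by move=> h /fH hH A; exact: lcosets_stable.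
- by apply/lcosetsP; exists 1; rewrite ?group1 ?lcoset1.
Qed.

(* Sigma-freeness makes the elements of H killed by f act trivially on H/K. *)
Lemma arrow_res_ker (P : NOp gT') (K H : {group gT}) :
  arrow (res f P) K H -> H :&: 'ker f \subset K.
Proof.
move=> [_ [x /(graph_fixed x (coset_graphE K H)) xH]].
apply/subsetP => h /setIP[hH hf]; have [Pfree _] := full_valP P #|H : K|.
have s1 : coset_perm K H h = 1.
  by apply: (Pfree x); rewrite -(xH h hH) /= (mker hf) gact1.
have /coset_enumP[i ei] : (K : {set gT}) \in lcosets K H.
  by apply/lcosetsP; exists 1; rewrite ?group1 ?lcoset1.
have := coset_permE i hH; rewrite s1 Sigma_1E ei => KE.
by rewrite KE lcoset_refl.
Qed.

(** By [arrow_res_ker], taking images under [f] is injective on the cosets of [K] in [H], so it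
    identifies [H]/[K] with [f(H)]/[f(K)]. *)
Lemma arrow_res_image (P : NOp gT') (K H : {group gT}) :
  arrow (res f P) K H -> arrow P (f @* K)%G (f @* H)%G.
Proof.
move=> KHP; have kerK := arrow_res_ker KHP.
have [KH /arrow_adm admK] := KHP; split; first exact: morphimS.
have fE (A : {set gT}) : f @* A = f @: A by rewrite /morphim setTI.
have fl x (A : {set gT}) : f @: (x *: A) = f x *: f @: A.
  apply/setP => y; apply/imsetP/lcosetP => [[_ /lcosetP[b bA ->] ->]|[_ /imsetP[b bA ->] ->]].
    by exists (f b); rewrite ?imset_f ?morphT.
  by exists (x * b); rewrite ?morphT // mem_lcoset mulKg.
apply/arrow_adm.
have -> : lcosets (f @* K)%G (f @* H)%G = (fun A : {set gT} => f @: A) @: lcosets K H.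
  apply/setP => A; apply/lcosetsP/imsetP => [[y]|[_ /lcosetsP[x xH ->] ->]].
    rewrite /= !fE => /imsetP[x xH ->] ->; exists (x *: K); last by rewrite fl.
    by apply/lcosetsP; exists x.
  by exists (f x); rewrite /= !fE ?imset_f ?fl.
rewrite /= fE; apply: adm_res_image admK; last by move=> h _ A _; exact: fl.
move=> _ _ /lcosetsP[x xH ->] /lcosetsP[y yH ->] fxy; apply/lcoset_eqP.
have : f x \in f @: (y *: K) by rewrite -fxy imset_f ?lcoset_refl.
case/imsetP => _ /lcosetP[k kK ->] fxk.
have kyx : k^-1 * (y^-1 * x) \in K.
  have kyxH : k^-1 * (y^-1 * x) \in H by rewrite !groupM ?groupV // (subsetP KH).
  apply: (subsetP kerK); rewrite inE kyxH; apply/kerP; first exact: in_setT.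
  by rewrite !morphT fxk !morphV ?inE // morphT mulKg mulVg.
by rewrite mem_lcoset -(mulKVg k (y^-1 * x)) groupM.
Qed.

Lemma arrow_res (P : NOp gT') :
  arrow_transfer (res_N f P) = fL f (arrow_transfer P).
Proof.
apply: transfer_ext => K H; split; last first.
  apply: (fLP f _).2 => _ _ [K' [H' [KH -> ->]]].
  exact: arrow_res_preim KH.
move=> KHP; have kerK := arrow_res_ker KHP; have [KH _] := KHP.
have fKH : fL f (arrow_transfer P) (f @*^-1 (f @* K))%G (f @*^-1 (f @* H))%G.
  apply: (fLP f _).1; exists (f @* K)%G, (f @* H)%G; split=> //.
  exact: arrow_res_image KHP.
have sH : H \subset f @*^-1 (f @* H) by rewrite -sub_morphim_pre ?subsetT.
(* The preimage of [f(K)] is ['ker f * K]; by the modular law it meets [H] in [(H :&: 'ker f) * K],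
   which is [K] by [kerK]. *)
have -> : K = (H :&: f @*^-1 (f @* K))%G; last exact: tr_res fKH sH.
apply/val_inj/eqP; rewrite eqEsubset /= subsetI KH -sub_morphim_pre ?subsetT //=.
by rewrite subxx morphimK ?subsetT // -group_modr // mul_subG.
Qed.

Lemma arrow_coind (O : NOp gT) :
  arrow_transfer (coind_N f O) = fR f (arrow_transfer O).
Proof.
apply: transfer_ext => K' H'; split.
  (* Pull the arrow back along [f], then push its fixed point along the counit from [res (coind O)]
     to [O]. *)
  apply: (fRP f _).2 => {}K' {}H' KHO; split; first by case: KHO.
  apply: (arrow_hom (coind_counit f O)).
  exact: (@arrow_res_preim (coind_N f O)).
move=> KHO; have KH := tr_sub KHO; split=> //; rewrite coset_graphE.
suff [p pH] : exists p : coind f O #|H' : K'|,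
    {in H', forall h, gact h p = sact p (coset_morphism K' H' h)}.
  by exists p; apply/(graph_fixed p erefl).
(* The value at [x] must be compatible with all [g] such that [f g ^ x] lies in [H']; these form
   [L], acting on [H']/[K'] by [a]. *)
apply: coind_fixed => x; pose L := (f @*^-1 (H' :^ x^-1))%G.
have memL g : (g \in L) = (f g ^ x \in H') by rewrite !inE /= mem_conjgV.
pose a g (A : {set gT'}) := f g ^ x *: A.
have a1 A : a 1 A = A by rewrite /a morph1 conj1g lcoset1.
have aM g h A : a (g * h) A = a g (a h A) by rewrite /a morphT conjMg lcosetM.
have admx : adm O L (lcosets K' H') a.
  apply: (adm_orbits _ a1 aM) => [n|g|].
  - by have [] := full_valP O n.
  - by rewrite memL => gH A; exact: lcosets_stable.
  (* [S] is the stabiliser in [L] of [z *: K']. As [z] normalises [H'], conjugating the given arrow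
     by [x * z] yields an arrow from [S] to [L]. *)
  move=> _ /lcosetsP[z zH ->]; pose S := (f @*^-1 (K' :^ (x * z)^-1))%G.
  have KHxz := ((fRP f _).1 _ _ (tr_conj (x * z) KHO)).2.
  have LE : L = (f @*^-1 (H' :^ (x * z)^-1)%G)%G.
    by apply: val_inj; rewrite /= invMg conjsgM (conjGid (groupVr zH)).
  have SH : S \subset L by rewrite LE; exact: tr_sub KHxz.
  have Sz g : g \in L -> (g \in S) = (a g (z *: K') == z *: K').
    move=> _; rewrite !inE /= mem_conjgV conjgM /a -lcosetM.
    rewrite [(f g ^ x) ^ z]conjgE -mem_lcoset.
    by apply/lcoset_eqP/eqP.
  apply: (adm_orbit a1 aM Sz SH).
  by apply/arrow_adm; rewrite LE; case: KHxz.
have [y yL] := adm_fixed (@coset_enum_inj _ K' H') (@coset_enumP _ K' H') admx.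
exists y => g gH; apply: yL => [|i]; first by rewrite memL.
exact: coset_permE.
Qed.

End Pullback.

Lemma Tr_functor_ext (gT : finGroupType) (C : category) (F G : functor C (Tr gT)) :
  (forall c, F c = G c) -> F = G.
Proof. by move=> FG; apply: (functor_ext (FG := FG)) => *; exact: Tr_thin. Qed.

Theorem proposition6p10 (gT gT' : finGroupType) (f : {morphism [set: gT] >-> gT'}) :
  comp_functor (Ho_arrow gT) (Ho_res f) = comp_functor (fL_functor f) (Ho_arrow gT')
  /\ comp_functor (Ho_arrow gT') (Ho_coind f) = comp_functor (fR_functor f) (Ho_arrow gT).
Proof.
(* Localization keeps the objects, and the induced functors act on them as the original ones, so
   each goal is convertible to the equality of transfer systems proved above. *)
split; apply: Tr_functor_ext => O; first exact: arrow_res.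
exact: arrow_coind.
Qed.
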